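(* Let $n>1$ be odd, let $X\subset\mathbb{CP}^{n+1}$ be the quadric hypersurface $\sum_{j=0}^nz_j^2-z_{n+1}^2=0$, and let $L\cong S^n$ be its real locus. Let $\overline{\mathrm{OGW}}_{\beta,k}$ be the (enhanced) open Gromov–Witten invariants of $(X,L)$, which are determined recursively by the open WDVV equations, the open Gromov–Witten axioms, the wall-crossing formula, the closed Gromov–Witten invariants of $X$, and the initial value $\overline{\mathrm{OGW}}_{1,3}=(-1)^{\frac{(n-2)(n-3)}2}2$. Suppose that the sign of the initial value is changed, and let $\overline{\mathrm{OGW}}'_{\beta,k}$ be the family determined by the same equations, axioms and closed invariants and the initial value $-\overline{\mathrm{OGW}}_{1,3}$. Then for all $\beta,k,l$ and all $I=(i_1,\dots,i_l)\in\{0,1,\dots,n\}^l$, $$\overline{\mathrm{OGW}}'_{\beta,k}(\Gamma_I)=(-1)^{\frac{k-1}2}\,\overline{\mathrm{OGW}}_{\beta,k}(\Gamma_I),\qquad \overline{\mathrm{OGW}}'_{\beta,k}(\Gamma_\diamond^{\otimes r},\Gamma_I)=(-1)^{\frac{k+r-1}2}\,\overline{\mathrm{OGW}}_{\beta,k}(\Gamma_\diamond^{\otimes r},\Gamma_I)\quad(r\ge0),$$ where $\Gamma_I=\Gamma_{i_1}\otimes\cdots\otimes\Gamma_{i_l}$; when $k$ (respectively $k+r$) is even, so that the sign is not defined, the identity is read as saying that both sides vanish.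
   Context: Topology. $X$ carries the restricted Fubini–Study form $\omega$; $h=[\omega]$; $\Delta_j=h^j$ ($0\le j\le n$) is a basis of $H^*(X;\mathbb{R})$, $\int_Xh^n=2$, $g^{ij}=\frac12\delta_{i,n-j}$ (inverse of the Poincaré pairing matrix). The natural map $\varpi:H_2(X;\mathbb{Z})\to H_2(X,L;\mathbb{Z})$ is an isomorphism, both groups identified with $\mathbb{Z}$ (a line being $1$), $\int_\beta h=\beta$, Maslov index $\mu(\beta)=2n\beta$. $L$ carries its unique relative spin structure with $w_{\mathfrak s}=0$. $\widehat H^*(X,L;\mathbb{R})$ is the cohomology of the complex $\{\eta\in A^*(X):\int_L\eta=0\}$; as $[L]=0$ there is a short exact sequence $0\to\mathbb{R}[-n-1]\to\widehat H^*(X,L;\mathbb{R})\xrightarrow{\rho}H^*(X;\mathbb{R})\to0$. Basis: $\Gamma_j=[\omega^j]$, $0\le j\le n$, $\rho(\Gamma_j)=\Delta_j$, and $\Gamma_\diamond=\Gamma_{n+1}$, the image of $1$ under the first map. $P_{\mathbb R}:\widehat H^*(X,L;\mathbb{R})\to\mathbb{R}$ is linear with $P_{\mathbb R}(\Gamma_\diamond)=1$, $P_{\mathbb R}(\Gamma_j)=0$ for $j\le n$ (equivalently a class $V\in H_{n+1}(X,L;\mathbb{R})$ with $\partial V=[L]$). Invariants. $\mathrm{GW}_\beta$: genus-zero Gromov–Witten invariants of $X$, with potential $\Phi(t_0,\dots,t_n)=\sum\frac{T^\beta\prod t_i^{r_i}}{\prod r_i!}\mathrm{GW}_\beta(\otimes\Delta_i^{\otimes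 r_i})$. $\overline{\mathrm{OGW}}_{\beta,k}:\widehat H^*(X,L;\mathbb{R})^{\otimes l}\to\mathbb{R}$ (symmetric, zero for $\beta<0$): enhanced open Gromov–Witten invariants of Solomon–Tukachinsky, the coefficients of $T^\beta s^k\prod t_i^{r_i}/(k!\prod r_i!)$ in the superpotential $(-1)^n\big(\sum_k\frac1{k+1}\langle\mathfrak m^\gamma_k(b^{\otimes k}),b\rangle+\mathfrak m^\gamma_{-1}\big)$ of the Fukaya $A_\infty$ algebra of $L$ (defined by $J$-holomorphic disks with boundary on $L$, bulk-deformed by $\gamma=\sum t_i\Gamma_i$) at a bounding chain $b$ with $\int_Lb=s$; when $k=0$ one adds the count of spheres meeting the interior constraints and carrying one further marked point on a chain representing $V$. Put $\overline\Omega(s,t_0,\dots,t_{n+1})=\sum\frac{T^\beta s^k\prod t_i^{r_i}}{k!\prod r_i!}\overline{\mathrm{OGW}}_{\beta,k}(\otimes\Gamma_i^{\otimes r_i})$. (Degree) $\overline{\mathrm{OGW}}_{\beta,k}(A_1,\dots,A_l)=0$ unless $n-3+\mu(\beta)+k+2l=kn+\sum_j|A_j|$. (Unit) $\overline{\mathrm{OGW}}_{\beta,k}(1,A_1,\dots,A_{l-1})$ equals $-1$ if $(\beta,k,l)=(0,1,1)$, $P_{\mathbb R}(A_1)$ if $(\beta,k,l)=(0,0,2)$, and $0$ otherwise. (Zero) $\overline{\mathrm{OGW}}_{0,k}(A_1,\dots,A_l)$ equals $-1$ if $(k,l)=(1,1)$ and $A_1=1$, $P_{\mathbb R}(A_1\smile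 A_2)$ if $(k,l)=(0,2)$, and $0$ otherwise (on basis inputs). (Divisor) If $|A_l|=2$: $\overline{\mathrm{OGW}}_{\beta,k}(A_1,\dots,A_l)=\int_\beta A_l\cdot\overline{\mathrm{OGW}}_{\beta,k}(A_1,\dots,A_{l-1})$. (Wall-crossing) $\overline{\mathrm{OGW}}_{\beta,k+1}(\eta_1,\dots,\eta_l)=-\overline{\mathrm{OGW}}_{\beta,k}(\Gamma_\diamond,\eta_1,\dots,\eta_l)$. (Open WDVV) For all $u,v,w\in\{0,\dots,n+1\}$, with sums over $0\le l,m\le n$ and $\partial_{t_{n+1}}\Phi:=0$: $$\sum_{l,m}\partial_{t_u}\partial_{t_l}\overline\Omega\,g^{lm}\,\partial_{t_m}\partial_{t_w}\partial_{t_v}\Phi-\partial_{t_u}\partial_s\overline\Omega\,\partial_{t_w}\partial_{t_v}\overline\Omega=\sum_{l,m}\partial_{t_u}\partial_{t_w}\partial_{t_l}\Phi\,g^{lm}\,\partial_{t_m}\partial_{t_v}\overline\Omega-\partial_{t_u}\partial_{t_w}\overline\Omega\,\partial_{t_v}\partial_s\overline\Omega,$$ $$\sum_{l,m}\partial_s\partial_{t_l}\overline\Omega\,g^{lm}\,\partial_{t_m}\partial_{t_w}\partial_{t_v}\Phi-\partial_s^2\overline\Omega\,\partial_{t_w}\partial_{t_v}\overline\Omega=-\partial_s\partial_{t_w}\overline\Omega\,\partial_{t_v}\partial_s\overline\Omega.$$ The invariants $\overline{\mathrm{OGW}}$ are known to satisfy all of these. *)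

(* Defs.v *)
From HB Require Import structures.
From mathcomp Require Import all_boot all_order all_algebra.
From mathcomp Require Import reals.

Set Implicit Arguments.
Unset Strict Implicit.
Unset Printing Implicit Defensive.

Import Order.TTheory GRing.Theory Num.Theory.
Local Open Scope ring_scope.

(* A power series in the finitely many variables V is the function giving,
   for each exponent vector, the (ordinary) coefficient of that monomial. *)
Section PowerSeries.
Variables (R : comNzRingType) (V : finType).

Definition expo := {ffun V -> nat}.
Definition fps := expo -> R.

Definition fps_d (x : V) (f : fps) : fps :=
  fun e => (e x).+1%:R * f [ffun y => e y + (y == x)]%N.

Definition fps_mul (f g : fps) : fps := fun e =>
  \sum_(d : {dffun forall x : V, 'I_(e x).+1})
    f [ffun x => d x : nat] * g [ffun x => e x - d x]%N.

End PowerSeries.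

Section Cohomology.
Variables (R : realType) (n : nat).

(* H^*(X; R), in the basis Delta_0, ..., Delta_n. *)
Definition HX := 'rV[R]_n.+1.
Definition Delta (j : 'I_n.+1) : HX := delta_mx 0 j.

Definition degHX (j : 'I_n.+1) : nat := j.*2.
Definition homogX (a : HX) (d : nat) : bool :=
  [forall j, (a 0 j != 0) ==> (degHX j == d)].

(* \int_X h^n = 2 *)
Definition intX (a : HX) : R := 2 * a 0 ord_max.

Definition cupX (a b : HX) : HX :=
  \sum_i \sum_j (a 0 i * b 0 j) *:
    (if (i + j <= n)%N then Delta (inord (i + j)) else 0).

(* \int_beta a for beta in H_2(X; Z) = Z, normalised by \int_beta h = beta. *)
Definition intbX (beta : int) (a : HX) : R := beta%:~R * a 0 (inord 1).

(* Inverse of the Poincare pairing matrix (2 delta_{i, n - j}). *)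
Definition ginv (i j : 'I_n.+1) : R := ((i + j)%N == n)%:R / 2.

(* \hat H^*(X, L; R), in the basis Gamma_0, ..., Gamma_n, Gamma_diamond;
   the index of Gamma_diamond is ord_max = n + 1. *)
Definition HXL := 'rV[R]_n.+2.
Definition Gamma (j : 'I_n.+2) : HXL := delta_mx 0 j.
Definition Gamma_diamond : HXL := Gamma ord_max.

Definition low (j : 'I_n.+1) : 'I_n.+2 := widen_ord (leqnSn n.+1) j.

Definition degHXL (j : 'I_n.+2) : nat := if j == ord_max then n.+1 else j.*2.
Definition homogXL (a : HXL) (d : nat) : bool :=
  [forall j, (a 0 j != 0) ==> (degHXL j == d)].

(* The projection onto Gamma_diamond. *)
Definition PR (a : HXL) : R := a 0 ord_max.

(* The only nonzero products involving Gamma_diamond are those with Gamma_0: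
   all the others have degree > n + 1 in the image of R[-n-1]. For i + j > n
   with i, j <= n the form omega^(i+j) vanishes. *)
Definition cupGamma (i j : 'I_n.+2) : HXL :=
  if (i + j <= n)%N then Gamma (inord (i + j))
  else if (nat_of_ord i == 0%N) || (nat_of_ord j == 0%N) then Gamma_diamond
  else 0.

Definition cupXL (a b : HXL) : HXL :=
  \sum_i \sum_j (a 0 i * b 0 j) *: cupGamma i j.

(* \int_beta a for beta in H_2(X, L; Z) = Z and a of degree 2; for n > 1 the
   degree-2 part of HXL is spanned by Gamma_1. *)
Definition intbXL (beta : int) (a : HXL) : R := beta%:~R * a 0 (inord 1).

(* Maslov index *)
Definition maslov (beta : int) : int := 2 * n%:Z * beta.

(* F is a family, over l, of symmetric multilinear forms on M^l. *)
Definition multilinear (M : lmodType R) (F : seq M -> R) : Prop :=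
  forall (A B : seq M) (c : R) (u v : M),
    F (A ++ c *: u + v :: B) = c * F (A ++ u :: B) + F (A ++ v :: B).

Definition symmetric_form (M : lmodType R) (F : seq M -> R) : Prop :=
  forall A B : seq M, perm_eq A B -> F A = F B.

(* beta |-> (A_1, ..., A_l) |-> GW_beta(A_1, ..., A_l) *)
Definition closed_family := int -> seq HX -> R.
(* beta |-> k |-> (A_1, ..., A_l) |-> OGW_{beta,k}(A_1, ..., A_l) *)
Definition open_family := int -> nat -> seq HXL -> R.

(* The formal variables T, s, t_0, ..., t_{n+1}. *)
Definition var : finType := (unit + unit + 'I_n.+2)%type.
Definition Tv : var := inl (inl tt).
Definition sv : var := inl (inr tt).
Definition tv (j : 'I_n.+2) : var := inr j.

Definition Phi (GW : closed_family) : fps R var := fun e =>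
  if (e sv == 0%N) && (e (tv ord_max) == 0%N) then
    GW (e Tv)%:Z (flatten [seq nseq (e (tv (low j))) (Delta j) | j : 'I_n.+1])
      / (\prod_(j < n.+1) (e (tv (low j)))`!)%:R
  else 0.

Definition Omega (OGW : open_family) : fps R var := fun e =>
  OGW (e Tv)%:Z (e sv) (flatten [seq nseq (e (tv j)) (Gamma j) | j : 'I_n.+2])
    / ((e sv)`! * \prod_(j < n.+2) (e (tv j))`!)%:R.

(* Moduli spaces of stable maps being unavailable, the genus-zero
   Gromov-Witten invariants of the n-dimensional quadric X are specified by
   the Kontsevich-Manin axioms and the one value they leave free:
   H^*(X; R) is generated by h and c_1(X) = n h, so by Kontsevich-Manin
   reconstruction at most one family satisfies closed_GW_quadric.
   The lines of X through a point sweep out the tangent hyperplane section at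
   that point, of degree 2, and h^n is twice the class of a point:
   this gives GW_1(h^(n-1), h^n) = 4. *)
Record closed_GW_quadric (GW : closed_family) : Prop := ClosedGWQuadric {
  cGW_multilinear : forall beta, multilinear (GW beta);
  cGW_symmetric : forall beta, symmetric_form (GW beta);
  cGW_effective : forall (beta : int) A, beta < 0 -> GW beta A = 0;
  cGW_degree : forall (beta : int) (A : seq HX) (d : seq nat),
    all2 homogX A d ->
    2 * (n%:Z - 3 + n%:Z * beta + (size A)%:Z) != (sumn d)%:Z ->
    GW beta A = 0;
  cGW_unit : forall (beta : int) (A : seq HX),
    GW beta (Delta ord0 :: A) =
      match A with
      | [:: a; b] => if beta == 0 then intX (cupX a b) else 0
      | _ => 0
      end;
  cGW_zero : forall A : seq HX,
    GW 0 A =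
      match A with
      | [:: a; b; c] => intX (cupX (cupX a b) c)
      | _ => 0
      end;
  cGW_divisor : forall (beta : int) (A : seq HX) (a : HX),
    beta != 0 -> homogX a 2 -> GW beta (rcons A a) = intbX beta a * GW beta A;
  cGW_WDVV : forall (a b c d : 'I_n.+1) (e : expo var),
    \sum_(l < n.+1) \sum_(m < n.+1) ginv l m *
      fps_mul (fps_d (tv (low a)) (fps_d (tv (low b))
                 (fps_d (tv (low l)) (Phi GW))))
              (fps_d (tv (low m)) (fps_d (tv (low c))
                 (fps_d (tv (low d)) (Phi GW)))) e
    = \sum_(l < n.+1) \sum_(m < n.+1) ginv l m *
      fps_mul (fps_d (tv (low a)) (fps_d (tv (low c))
                 (fps_d (tv (low l)) (Phi GW))))
              (fps_d (tv (low m)) (fps_d (tv (low b))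
                 (fps_d (tv (low d)) (Phi GW)))) e;
  cGW_line : GW 1 [:: Delta (inord n.-1); Delta ord_max] = 4
}.

(* The disk invariants enter only through these properties, which together
   with the value of OGW_{1,3} determine them recursively. *)
Record open_GW_axioms (GW : closed_family) (OGW : open_family) : Prop :=
  OpenGWAxioms {
  oGW_multilinear : forall beta k, multilinear (OGW beta k);
  oGW_symmetric : forall beta k, symmetric_form (OGW beta k);
  oGW_effective : forall (beta : int) k A, beta < 0 -> OGW beta k A = 0;
  oGW_degree : forall (beta : int) (k : nat) (A : seq HXL) (d : seq nat),
    all2 homogXL A d ->
    n%:Z - 3 + maslov beta + k%:Z + 2 * (size A)%:Z
      != k%:Z * n%:Z + (sumn d)%:Z ->
    OGW beta k A = 0;
  oGW_unit : forall (beta : int) (k : nat) (A : seq HXL),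
    OGW beta k (Gamma ord0 :: A) =
      match A with
      | [::] => if (beta == 0) && (k == 1%N) then -1 else 0
      | [:: a] => if (beta == 0) && (k == 0%N) then PR a else 0
      | _ => 0
      end;
  oGW_zero : forall (k : nat) (I : seq 'I_n.+2),
    OGW 0 k (map Gamma I) =
      match I with
      | [:: i] => if (k == 1%N) && (i == ord0) then -1 else 0
      | [:: i; j] => if k == 0%N then PR (cupXL (Gamma i) (Gamma j)) else 0
      | _ => 0
      end;
  oGW_divisor : forall (beta : int) (k : nat) (A : seq HXL) (a : HXL),
    homogXL a 2 -> OGW beta k (rcons A a) = intbXL beta a * OGW beta k A;
  oGW_wall_crossing : forall (beta : int) (k : nat) (A : seq HXL),
    OGW beta k.+1 A = - OGW beta k (Gamma_diamond :: A);
  oGW_WDVV_interior : forall (u v w : 'I_n.+2) (e : expo var),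
    \sum_(l < n.+1) \sum_(m < n.+1) ginv l m *
      fps_mul (fps_d (tv u) (fps_d (tv (low l)) (Omega OGW)))
              (fps_d (tv (low m)) (fps_d (tv w) (fps_d (tv v) (Phi GW)))) e
    - fps_mul (fps_d (tv u) (fps_d sv (Omega OGW)))
              (fps_d (tv w) (fps_d (tv v) (Omega OGW))) e
    = \sum_(l < n.+1) \sum_(m < n.+1) ginv l m *
      fps_mul (fps_d (tv u) (fps_d (tv w) (fps_d (tv (low l)) (Phi GW))))
              (fps_d (tv (low m)) (fps_d (tv v) (Omega OGW))) e
    - fps_mul (fps_d (tv u) (fps_d (tv w) (Omega OGW)))
              (fps_d (tv v) (fps_d sv (Omega OGW))) e;
  oGW_WDVV_boundary : forall (v w : 'I_n.+2) (e : expo var),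
    \sum_(l < n.+1) \sum_(m < n.+1) ginv l m *
      fps_mul (fps_d sv (fps_d (tv (low l)) (Omega OGW)))
              (fps_d (tv (low m)) (fps_d (tv w) (fps_d (tv v) (Phi GW)))) e
    - fps_mul (fps_d sv (fps_d sv (Omega OGW)))
              (fps_d (tv w) (fps_d (tv v) (Omega OGW))) e
    = - fps_mul (fps_d sv (fps_d (tv w) (Omega OGW)))
                (fps_d (tv v) (fps_d sv (Omega OGW))) e
}.

(* OGW_{1,3} = (-1)^((n-2)(n-3)/2) 2; the exponent is an integer. *)
Definition initial_value : R := (-1) ^+ (((n - 2) * (n - 3)) %/ 2)%N * 2.

(* x' = (-1)^((p-1)/2) x, read as x' = x = 0 when p is even. *)
Definition sign_related (p : nat) (x' x : R) : Prop :=
  if odd p then x' = (-1) ^+ (p.-1)./2 * x else x' = 0 /\ x = 0.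

Definition Gamma_seq (I : seq 'I_n.+1) : seq HXL :=
  [seq Gamma (low i) | i <- I].

End Cohomology.

(* Main.v *)
(* By wall-crossing, d/ds Omega = - d/dt_diamond Omega, so the superpotential is
   a series in T, t_0, ..., t_n and t_diamond - s, and p = k + r is the weight
   of a coefficient. The open WDVV equations and the axioms are homogeneous for
   this weight: for every complex z <> 0, z^-1 Omega(z s, z t_diamond) satisfies
   them as well, with initial value multiplied by z^2.
   The equations have at most one solution with a given initial value. Indeed,
   let D be the difference of two solutions, vanishing below T-degree b > 0. In
   T-degree b the products of two derivatives of Omega agree, and the equations
   become linear in D:
   - D_(diamond, a) = 0 for a > 1;
   - D_(a, c) = D_(a + c - 1, 1), so that by the divisor axiom interior
     insertions merge into a single one, which the degree axiom excludes in the
     absence of boundary insertions;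
   - for the coefficient x of T^b t_diamond^p, the equation (diamond, 1, n) in
     T-degree b + 1, with GW_1(h^(n-1), h, h^n) = 4 and OGW_1(diamond, h^n) = -2,
     gives 2 p (2 b - p + 1) x = 0, whereas p = 2 b + 1 and the degree axiom
     force b = 1, where x is the initial value.
   For z = i the rescaled series has the opposite initial value, hence it is the
   superpotential of OGW'. When p is even the comparison equates a real number
   with an imaginary one, so both vanish. *)
Require Import Defs.
From mathcomp Require Import all_boot all_order all_algebra.
From mathcomp Require Import reals boolp complex.
From mathcomp Require Import zify ring.

Set Implicit Arguments.
Unset Strict Implicit.
Unset Printing Implicit Defensive.

Import Order.TTheory GRing.Theory Num.Theory.
Local Open Scope ring_scope.

(** * Power series *)

Section Series.
Variables (K : comNzRingType) (V : finType).
Implicit Types (f g : fps K V) (e d : expo V) (x y : V).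

Definition inc x e : expo V := [ffun y => e y + (y == x)]%N.
Definition dec x e : expo V := [ffun y => e y - (y == x)]%N.
Definition esub e d : expo V := [ffun y => e y - d y]%N.
Definition fsub f g : fps K V := fun e => f e - g e.

Lemma expoP e d : (forall x, e x = d x) -> e = d.
Proof. by move/ffunP. Qed.

Lemma decK x e : (0 < e x)%N -> inc x (dec x e) = e.
Proof.
by move=> ex; apply/ffunP=> y; rewrite !ffunE; case: eqP => [->|_] /=; lia.
Qed.

Lemma incC x y e : inc x (inc y e) = inc y (inc x e).
Proof. by apply/ffunP=> z; rewrite !ffunE addnAC. Qed.

Lemma fps_dE x f e : fps_d x f e = (e x).+1%:R * f (inc x e).
Proof. by []. Qed.

Lemma fps_dB x f g : fps_d x (fsub f g) = fsub (fps_d x f) (fps_d x g).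
Proof. by apply/funext => e; rewrite /fsub !fps_dE mulrBr. Qed.

Lemma fps_dC x y f : fps_d x (fps_d y f) = fps_d y (fps_d x f).
Proof.
apply/funext => e; rewrite !fps_dE incC !ffunE.
case: (eqVneq x y) => [-> //|nxy].
by rewrite !addn0 mulrCA.
Qed.

Lemma fps_mul_eq0 f g e :
  (forall d, (forall x, d x <= e x)%N -> f d * g (esub e d) = 0) ->
  fps_mul f g e = 0.
Proof.
move=> H; apply: big1 => d _; set d' := finfun _ in H *.
have := H [ffun x => d x : nat].
have -> : esub e [ffun x => d x : nat] = [ffun x => e x - d x]%N.
  by apply/ffunP=> x; rewrite !ffunE.
by apply=> x; rewrite ffunE -ltnS.
Qed.

Lemma fps_mul_single d0 f g e : (forall x, d0 x <= e x)%N ->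
  (forall d, (forall x, d x <= e x)%N -> d != d0 -> f d * g (esub e d) = 0) ->
  fps_mul f g e = f d0 * g (esub e d0).
Proof.
move=> le_d0 H.
pose D0 : {dffun forall x : V, 'I_(e x).+1} := [ffun x => inord (d0 x)].
have D0E x : D0 x = d0 x :> nat by rewrite ffunE inordK ?ltnS.
rewrite /fps_mul (bigD1 D0) //= big1 ?addr0 => [|d nd].
  congr (f _ * g _); apply/ffunP=> x; rewrite !ffunE /= inordK ?ltnS //.
have -> : [ffun x => e x - d x]%N = esub e [ffun x => d x : nat].
  by apply/ffunP=> x; rewrite !ffunE.
apply: H => [x|]; first by rewrite ffunE -ltnS.
apply: contraNneq nd => E; apply/eqP/ffunP => x; apply/val_inj.
by rewrite /= D0E -E ffunE.
Qed.

Lemma fps_mulBl f f' g e :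
  fps_mul (fsub f f') g e = fps_mul f g e - fps_mul f' g e.
Proof. by rewrite /fps_mul -sumrB; apply: eq_bigr => d _; exact: mulrBl. Qed.

Lemma fps_mulBr f g g' e :
  fps_mul f (fsub g g') e = fps_mul f g e - fps_mul f g' e.
Proof. by rewrite /fps_mul -sumrB; apply: eq_bigr => d _; exact: mulrBr. Qed.

Lemma fps_mulB f g f' g' e :
  fps_mul f g e - fps_mul f' g' e
  = fps_mul (fsub f f') g e + fps_mul f' (fsub g g') e.
Proof. by rewrite fps_mulBl fps_mulBr addrA subrK. Qed.

Lemma fps_mulNl f g e : fps_mul (fun d => - f d) g e = - fps_mul f g e.
Proof. by rewrite /fps_mul -sumrN; apply: eq_bigr => d _; rewrite mulNr. Qed.

Lemma fps_mulNr f g e : fps_mul f (fun d => - g d) e = - fps_mul f g e.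
Proof. by rewrite /fps_mul -sumrN; apply: eq_bigr => d _; rewrite mulrN. Qed.

(** * Order of vanishing in a distinguished variable [T] *)

Variable T : V.

Definition vanish b f := forall e, (e T < b)%N -> f e = 0.

Lemma vanish_d b f x : x != T -> vanish b f -> vanish b (fps_d x f).
Proof.
by move=> nx Hf e He; rewrite fps_dE Hf ?mulr0 // ffunE eq_sym (negbTE nx) addn0.
Qed.

Lemma vanish_mul a b f g e : vanish a f -> vanish b g -> (e T < a + b)%N ->
  fps_mul f g e = 0.
Proof.
move=> Hf Hg He; apply: fps_mul_eq0 => d le_d.
case: (ltnP (d T) a) => Hd; first by rewrite Hf ?mul0r.
by rewrite Hg ?mulr0 // ffunE; have := le_d T; lia.
Qed.

(** In fg - f'g' = (f - f')g + f'(g - g') each product has one factor of order [b] and one of order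
    1, so the difference has order at least b + 1. *)
Lemma fps_mul_agree b f g f' g' e : vanish 1 f' -> vanish 1 g ->
  vanish b (fsub f f') -> vanish b (fsub g g') -> (e T <= b)%N ->
  fps_mul f g e = fps_mul f' g' e.
Proof.
move=> F G DF DG He; apply/eqP; rewrite -subr_eq0 fps_mulB.
by rewrite (vanish_mul DF G) ?(vanish_mul F DG) ?addr0 //; lia.
Qed.

(** In the lowest degree [b] of [f] only the [T]-free part of [g] can contribute, and that part is
    the constant [c]. *)
Lemma fps_mul_constr b f g c e : vanish b f ->
  (forall d, d T = 0%N -> g d = c * (d == [ffun=> 0%N])%:R) -> e T = b ->
  fps_mul f g e = f e * c.
Proof.
move=> Hf Hg He.
have ee : esub e e = [ffun=> 0%N] by apply/ffunP=> x; rewrite !ffunE subnn.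
rewrite (@fps_mul_single e) // ?ee ?Hg ?ffunE ?eqxx ?mulr1 // => d le_d nd.
case: (ltnP (d T) b) => Hd; first by rewrite Hf ?mul0r.
rewrite Hg; last by rewrite ffunE; have := le_d T; lia.
suff /negbTE -> : esub e d != [ffun=> 0%N] by rewrite !mulr0.
apply: contraNneq nd => E; apply/eqP/expoP => x; have := le_d x.
by move/ffunP/(_ x): E; rewrite !ffunE; lia.
Qed.

Lemma fps_mul_constl b f g c e : vanish b g ->
  (forall d, d T = 0%N -> f d = c * (d == [ffun=> 0%N])%:R) -> e T = b ->
  fps_mul f g e = c * g e.
Proof.
move=> Hg Hf He.
have ee : esub e [ffun=> 0%N] = e by apply/ffunP=> x; rewrite !ffunE subn0.
rewrite (@fps_mul_single [ffun=> 0%N]) ?ee ?Hf ?ffunE ?eqxx ?mulr1 //.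
  by move=> x; rewrite ffunE.
move=> d le_d nd; case: (posnP (d T)) => Hd.
  by rewrite Hf // (negbTE nd) mulr0 mul0r.
by rewrite Hg ?mulr0 // ffunE; have := le_d T; lia.
Qed.

End Series.

(** * Uniqueness for the recursion *)

Section Recursion.
Variables (K : numFieldType) (n : nat).
Implicit Types (F Ph : fps K (var n)) (e : expo (var n)) (i j l m : 'I_n.+1).

Notation T := (Tv n).
Notation s := (sv n).
Definition dia : var n := tv ord_max.
Definition t i : var n := tv (low i).
Definition e0 : expo (var n) := [ffun=> 0%N].
(** The degree axiom reads an exponent through [cnt], the number of insertions Gamma_j with j <= n,
    and [wt], half of their total degree. *)
Definition cnt e : nat := \sum_(j < n.+1) e (t j).
Definition wt e : nat := \sum_(j < n.+1) j * e (t j).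
(* The monomial T^b t_diamond^p. *)
Definition TP b p : expo (var n) :=
  [ffun y => if y == T then b else if y == dia then p else 0%N].
Definition gK l m : K := (l + m == n)%N%:R / 2.

(** [cs_const] is the classical triple product, the integral of h^(i+j+l); [cs_line] is
    GW_1(h^(n-1), h, h^n). *)
Record closed_series Ph : Prop := ClosedSeries {
  cs_supp : forall e, (0 < e s + e dia)%N -> Ph e = 0;
  cs_const : forall i j l e, e T = 0%N ->
    fps_d (t i) (fps_d (t j) (fps_d (t l) Ph)) e
    = 2 * (i + (j + l) == n)%N%:R * (e == [ffun=> 0%N])%:R;
  cs_line : fps_d (t (inord n.-1)) (fps_d (t (inord 1))
    (fps_d (t ord_max) Ph)) (TP 1 0) = 4
}.

(* The constraints on Omega once d/ds is replaced by - d/dt_diamond; the second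
   open WDVV equation is then the case u = n + 1 of the first. *)
Record open_series Ph F : Prop := OpenSeries {
  os_degree : forall e, e s = 0%N ->
    (n + 2 * n * e T + 2 * cnt e + 2 * e dia
       != 3 + n.+1 * e dia + 2 * wt e)%N -> F e = 0;
  os_unit : forall e, fps_d (t ord0) F e = (e == inc dia e0)%:R - (e == inc s e0)%:R;
  os_zero : forall e, e T = 0%N -> e (t ord0) = 0%N -> F e = 0;
  os_divisor : forall e, fps_d (t (inord 1)) F e = (e T)%:R * F e;
  os_wall : forall e, fps_d s F e = - fps_d dia F e;
  os_WDVV : forall (u : 'I_n.+2) i j e,
    \sum_(l < n.+1) \sum_(m < n.+1) gK l m *
      fps_mul (fps_d (tv u) (fps_d (t l) F))
              (fps_d (t m) (fps_d (t i) (fps_d (t j) Ph))) e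
    + fps_mul (fps_d (tv u) (fps_d dia F)) (fps_d (t i) (fps_d (t j) F)) e
    = \sum_(l < n.+1) \sum_(m < n.+1) gK l m *
      fps_mul (fps_d (tv u) (fps_d (t i) (fps_d (t l) Ph)))
              (fps_d (t m) (fps_d (t j) F)) e
    + fps_mul (fps_d (tv u) (fps_d (t i) F)) (fps_d (t j) (fps_d dia F)) e
}.

(** * Variables, products along the monomials [T^b t_diamond^p], contraction with the pairing *)

Lemma t_eq i j : (t i == t j) = (i == j).
Proof. by []. Qed.

Lemma t_dia i : (t i == dia) = false.
Proof. by apply/negbTE; change (low i != ord_max); rewrite -val_eqE /= neq_ltn ltn_ord. Qed.

Lemma dia_t i : (dia == t i) = false.
Proof. by rewrite eq_sym t_dia. Qed.

Lemma Ts_eq : ((T == s) = false) * ((s == T) = false) * ((T == dia) = false)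
  * ((dia == T) = false) * ((s == dia) = false) * ((dia == s) = false).
Proof. by []. Qed.

Lemma Ts_t i : ((T == t i) = false) * ((t i == T) = false) * ((s == t i) = false)
  * ((t i == s) = false).
Proof. by []. Qed.

Definition var_eqE := (t_eq, t_dia, dia_t, Ts_eq, Ts_t, eqxx).

Lemma cnt_inc i e : cnt (inc (t i) e) = (cnt e).+1.
Proof.
rewrite /cnt; under eq_bigr do rewrite ffunE var_eqE.
rewrite big_split /= (bigD1 i (F := fun j => nat_of_bool (j == i))) //= eqxx.
by rewrite [X in (_ + (_ + X))%N]big1 => [|j /negbTE->]; rewrite ?addn0 ?addn1.
Qed.

Lemma wt_inc i e : wt (inc (t i) e) = (wt e + i)%N.
Proof.
rewrite /wt; under eq_bigr do rewrite ffunE var_eqE mulnDr.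
rewrite big_split /= (bigD1 i (F := fun j : 'I_n.+1 => (j * (j == i))%N)) //= eqxx.
by rewrite [X in (_ + (_ + X))%N]big1 => [|j /negbTE->]; rewrite ?muln0 ?addn0 ?muln1.
Qed.

Lemma cnt_TP b p : cnt (TP b p) = 0%N.
Proof. by rewrite /cnt big1 // => j _; rewrite ffunE !var_eqE. Qed.

Lemma wt_TP b p : wt (TP b p) = 0%N.
Proof. by rewrite /wt big1 // => j _; rewrite ffunE !var_eqE muln0. Qed.

Lemma inc_dia_TP b p : inc dia (TP b p) = TP b p.+1.
Proof.
apply: expoP => x; rewrite !ffunE; case: (eqVneq x T) => [->|_].
  by rewrite var_eqE addn0.
by case: eqP; rewrite ?addn1.
Qed.

Lemma TP_T b p : TP b p T = b.
Proof. by rewrite ffunE eqxx. Qed.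

Lemma TP_dia b p : TP b p dia = p.
Proof. by rewrite ffunE eqxx. Qed.

Lemma TP_t b p i : TP b p (t i) = 0%N.
Proof. by rewrite ffunE !var_eqE. Qed.

Lemma TP_s b p : TP b p s = 0%N.
Proof. by rewrite ffunE. Qed.

Lemma le_TP b p e : (forall x, e x <= TP b p x)%N -> e = TP (e T) (e dia).
Proof.
move=> H; apply: expoP => x; have := H x; rewrite !ffunE.
by case: eqP => [->//|_]; case: eqP => [->//|_]; lia.
Qed.

Lemma esub_TP b p b' p' : esub (TP b p) (TP b' p') = TP (b - b') (p - p').
Proof. by apply: expoP => x; rewrite !ffunE; do 2![case: eqP => // _]. Qed.

Lemma var_ind (P : var n -> Prop) : P T -> P s -> P dia -> (forall i, P (t i)) ->
  forall x, P x.
Proof.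
move=> PT Ps Pd Pt [[[]|[]]|j] //; case: (unliftP ord_max j) => [i ->|-> //].
suff -> : lift ord_max i = low i by apply: Pt.
by apply: val_inj; rewrite /= /bump leqNgt ltn_ord.
Qed.

Lemma eq_TP e : e s = 0%N -> (forall i, e (t i) = 0%N) -> e = TP (e T) (e dia).
Proof.
move=> es et; apply: expoP; apply: var_ind => [|||i].
- by rewrite TP_T.
- by rewrite TP_s.
- by rewrite TP_dia.
- by rewrite TP_t.
Qed.

(** The orders of vanishing force the splitting of T^(b+1) into T^b for [f] and T for [g]; there the
    only power of t_diamond in [g] is the [q]-th. *)
Lemma fps_mul_TP (f g : fps K (var n)) b p q : vanish T b f -> vanish T 1 g -> (q <= p)%N ->
  (forall h : nat, h != q -> g (TP 1 h) = 0) ->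
  fps_mul f g (TP b.+1 p) = f (TP b (p - q)) * g (TP 1 q).
Proof.
move=> Hf Hg qp Hq.
rewrite (@fps_mul_single _ _ (TP b (p - q))) ?esub_TP ?subSnn ?subKn //.
  by move=> x; rewrite !ffunE; case: eqP => // _; case: eqP => // _; exact: leq_subr.
move=> d le_d nd; have := le_d dia; have := le_d T; rewrite TP_T TP_dia => dT dp.
case: (ltnP (d T) b) => Hd; first by rewrite Hf ?mul0r.
case: (ltnP b (d T)) => Hd'; first by rewrite Hg ?mulr0 // ffunE TP_T; lia.
have {Hd Hd' dT} dT : d T = b by lia.
move: nd; rewrite (le_TP le_d) esub_TP dT subSnn => nd.
rewrite Hq ?mulr0 //; apply: contraNneq nd => <-.
by rewrite subKn.
Qed.

Lemma fps_mul_TP_eq0 (f g : fps K (var n)) b p : vanish T 1 f -> vanish T b g ->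
  (forall h : nat, g (TP b h) = 0) -> fps_mul f g (TP b.+1 p) = 0.
Proof.
move=> Hf Hg Hq; apply: fps_mul_eq0 => d le_d.
have := le_d T; rewrite TP_T => dT; rewrite (le_TP le_d) esub_TP.
case: (posnP (d T)) => Hd; first by rewrite Hf ?mul0r // TP_T Hd.
case: (ltnP 1 (d T)) => Hd'; first by rewrite Hg ?mulr0 // TP_T; lia.
have -> : (b.+1 - d T = b)%N by lia.
by rewrite Hq mulr0.
Qed.

(** Characteristic zero: this turns an identity between derivatives into the vanishing of a
    coefficient. *)
Lemma dec_eq0 x F e : (0 < e x)%N -> fps_d x F (dec x e) = 0 -> F e = 0.
Proof.
move=> ex; rewrite fps_dE decK // => /eqP.
by rewrite mulf_eq0 pnatr_eq0 /= => /eqP.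
Qed.

(** [gK] inverts the Poincaré pairing, so the contraction substitutes [c] for [l]; the default 0
    reflects h^c = 0 for c > n. *)
Lemma sum_gKr (f : 'I_n.+1 -> K) c :
  \sum_(l < n.+1) \sum_(m < n.+1) gK l m * (f l * (2 * (m + c == n)%N%:R))
  = if (c <= n)%N then f (inord c) else 0.
Proof.
have H (l m : 'I_n.+1) : (c <= n)%N ->
    gK l m * (f l * (2 * (m + c == n)%N%:R))
    = (if (l == inord c) && (m == inord (n - c)) then f l else 0).
  move=> cn; rewrite -!val_eqE /= !inordK ?ltnS ?leq_subr // /gK.
  have -> : (m + c == n)%N = (m == n - c :> nat)%N by apply/eqP/eqP; lia.
  case: (eqVneq (m : nat)) => [->|]; last by rewrite andbF !mulr0.
  have -> : (l + (n - c) == n)%N = (l == c :> nat) by apply/eqP/eqP; lia.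
  by case: eqP => _ /=; rewrite ?mul0r // mul1r mulr1 mulrC mulfK ?pnatr_eq0.
case: ifP => cn.
  rewrite (bigD1 (inord c)) //= (bigD1 (inord (n - c))) //=.
  rewrite H // !eqxx /= !big1 ?addr0 // => [l nl|m nm].
    by rewrite big1 // => m _; rewrite H // (negbTE nl).
  by rewrite H // (negbTE nm) andbF.
rewrite big1 // => l _; rewrite big1 // => m _.
have -> : (m + c == n)%N = false by apply/eqP; lia.
by rewrite !mulr0.
Qed.

Lemma sum_gKl (f : 'I_n.+1 -> K) c :
  \sum_(l < n.+1) \sum_(m < n.+1) gK l m * (2 * (l + c == n)%N%:R * f m)
  = if (c <= n)%N then f (inord c) else 0.
Proof.
rewrite exchange_big -sum_gKr; apply: eq_bigr => l _; apply: eq_bigr => m _.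
by rewrite /gK addnC [f l * _]mulrC.
Qed.

(** By the zero and unit axioms the [T]-free part of [F] is t_0 (t_diamond - s), which two
    derivatives in variables other than t_0 annihilate. *)
Lemma open_vanish Ph F x y : open_series Ph F ->
  x != T -> x != t ord0 -> y != T -> y != t ord0 ->
  vanish T 1 (fps_d x (fps_d y F)).
Proof.
move=> hF xT x0 yT y0 e; rewrite ltnS leqn0 => /eqP eT.
rewrite !fps_dE; suff -> : F (inc y (inc x e)) = 0 by rewrite !mulr0.
set e2 := inc y _.
have e2T : e2 T = 0%N.
  by rewrite !ffunE eT eq_sym (negbTE xT) eq_sym (negbTE yT).
case: (posnP (e2 (t ord0))) => e20; first exact: (os_zero hF).
apply: (dec_eq0 e20); rewrite (os_unit hF).
have H v : (dec (t ord0) e2 == inc v e0) = false.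
  apply/eqP => E; have Ex := congr1 (fun f : expo _ => f x) E.
  have Ey := congr1 (fun f : expo _ => f y) E; move: Ex Ey.
  rewrite /= !ffunE !eqxx (negbTE x0) (negbTE y0).
  case: (eqVneq x y) => [<-|nxy]; first by case: (x == v) => /=; lia.
  case: (eqVneq x v) nxy => [->|_ _] /=; last by lia.
  by rewrite eq_sym => /negbTE ->; lia.
by rewrite !H subrr.
Qed.

(** * The difference of two solutions in its lowest [T]-degree *)

Section Uniqueness.
Hypothesis n_gt1 : (1 < n)%N.
Variables (Ph F G : fps K (var n)).
Hypothesis (hPh : closed_series Ph) (hF : open_series Ph F)
  (hG : open_series Ph G).

Let D := fsub F G.

(** Both solutions share [Ph], so the terms containing it are linear in [D]; only the quadratic
    terms remain as differences. *)
Lemma D_WDVV_gen (u : 'I_n.+2) i j e :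
  \sum_(l < n.+1) \sum_(m < n.+1) gK l m *
    fps_mul (fps_d (tv u) (fps_d (t l) D))
            (fps_d (t m) (fps_d (t i) (fps_d (t j) Ph))) e
  + (fps_mul (fps_d (tv u) (fps_d dia F)) (fps_d (t i) (fps_d (t j) F)) e
     - fps_mul (fps_d (tv u) (fps_d dia G)) (fps_d (t i) (fps_d (t j) G)) e)
  = \sum_(l < n.+1) \sum_(m < n.+1) gK l m *
    fps_mul (fps_d (tv u) (fps_d (t i) (fps_d (t l) Ph)))
            (fps_d (t m) (fps_d (t j) D)) e
  + (fps_mul (fps_d (tv u) (fps_d (t i) F)) (fps_d (t j) (fps_d dia F)) e
     - fps_mul (fps_d (tv u) (fps_d (t i) G)) (fps_d (t j) (fps_d dia G)) e).
Proof.
have dl l m : gK l m * fps_mul (fps_d (tv u) (fps_d (t l) D))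
    (fps_d (t m) (fps_d (t i) (fps_d (t j) Ph))) e
  = gK l m * fps_mul (fps_d (tv u) (fps_d (t l) F))
    (fps_d (t m) (fps_d (t i) (fps_d (t j) Ph))) e
  - gK l m * fps_mul (fps_d (tv u) (fps_d (t l) G))
    (fps_d (t m) (fps_d (t i) (fps_d (t j) Ph))) e.
  by rewrite /D !fps_dB fps_mulBl mulrBr.
have dr l m : gK l m * fps_mul (fps_d (tv u) (fps_d (t i) (fps_d (t l) Ph)))
    (fps_d (t m) (fps_d (t j) D)) e
  = gK l m * fps_mul (fps_d (tv u) (fps_d (t i) (fps_d (t l) Ph)))
    (fps_d (t m) (fps_d (t j) F)) e
  - gK l m * fps_mul (fps_d (tv u) (fps_d (t i) (fps_d (t l) Ph)))
    (fps_d (t m) (fps_d (t j) G)) e.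
  by rewrite /D !fps_dB fps_mulBr mulrBr.
under eq_bigr do under eq_bigr do rewrite dl.
under eq_bigr do rewrite sumrB.
under [in RHS]eq_bigr do under eq_bigr do rewrite dr.
under [in RHS]eq_bigr do rewrite sumrB.
rewrite !sumrB.
have := os_WDVV hF u i j e; have := os_WDVV hG u i j e.
set a1 := \sum_l _; set a2 := fps_mul _ _ e.
set a3 := \sum_l _; set a4 := fps_mul _ _ e.
set b1 := \sum_l _; set b2 := fps_mul _ _ e.
set b3 := \sum_l _; set b4 := fps_mul _ _ e.
move=> EG EF.
by rewrite addrACA EF -opprD EG opprD addrACA.
Qed.

Lemma t_n0 i : (0 < i)%N -> t i != t ord0.
Proof. by rewrite t_eq -val_eqE /= lt0n. Qed.

Variable b : nat.
Hypothesis hD : vanish T b D.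

Let hDd x y : x != T -> y != T ->
  vanish T b (fsub (fps_d x (fps_d y F)) (fps_d x (fps_d y G))).
Proof. by move=> xT yT; rewrite -!fps_dB; apply: vanish_d => //; apply: vanish_d. Qed.

(* All second derivatives of Omega in variables other than t_0 vanish at T = 0, so
   the quadratic terms of the equation only see T-degrees where D vanishes. *)
Lemma D_WDVV (u : 'I_n.+2) i j e : tv u != t ord0 -> (0 < i)%N -> (0 < j)%N ->
  e T = b ->
  \sum_(l < n.+1) \sum_(m < n.+1) gK l m *
    fps_mul (fps_d (tv u) (fps_d (t l) D))
            (fps_d (t m) (fps_d (t i) (fps_d (t j) Ph))) e
  = \sum_(l < n.+1) \sum_(m < n.+1) gK l m *
    fps_mul (fps_d (tv u) (fps_d (t i) (fps_d (t l) Ph)))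
            (fps_d (t m) (fps_d (t j) D)) e.
Proof.
move=> u0 i0 j0 eT; have := D_WDVV_gen u i j e.
have i0' := t_n0 i0; have j0' := t_n0 j0.
have dia0 : dia != t ord0 by rewrite dia_t.
rewrite (@fps_mul_agree _ _ T b (fps_d (tv u) (fps_d dia F)) _
  (fps_d (tv u) (fps_d dia G)) (fps_d (t i) (fps_d (t j) G))) ?eT //; last first.
- exact: hDd.
- exact: hDd.
- exact: open_vanish hF _ _ _ _.
- exact: open_vanish hG _ _ _ _.
rewrite (@fps_mul_agree _ _ T b (fps_d (tv u) (fps_d (t i) F)) _
  (fps_d (tv u) (fps_d (t i) G)) (fps_d (t j) (fps_d dia G))) ?eT //; last first.
- exact: hDd.
- exact: hDd.
- exact: open_vanish hF _ _ _ _.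
- exact: open_vanish hG _ _ _ _.
by rewrite !subrr !addr0.
Qed.

(** [D] already uses up the whole [T]-degree [b], so [Ph] enters only through classical triple
    products, which combine h^i and h^j into h^(i+j). *)
Lemma D_WDVV_lhs (u : 'I_n.+2) i j e : e T = b ->
  \sum_(l < n.+1) \sum_(m < n.+1) gK l m *
    fps_mul (fps_d (tv u) (fps_d (t l) D))
            (fps_d (t m) (fps_d (t i) (fps_d (t j) Ph))) e
  = if (i + j <= n)%N then fps_d (tv u) (fps_d (t (inord (i + j))) D) e else 0.
Proof.
move=> eT; rewrite -(sum_gKr (fun l => fps_d (tv u) (fps_d (t l) D) e)).
apply: eq_bigr => l _; apply: eq_bigr => m _; congr (_ * _).
apply: (fps_mul_constr (T := T) (b := b)) => // [|d dT]; last exact: cs_const.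
by apply: vanish_d => //; apply: vanish_d.
Qed.

Lemma D_WDVV_rhs k i j e : e T = b ->
  \sum_(l < n.+1) \sum_(m < n.+1) gK l m *
    fps_mul (fps_d (t k) (fps_d (t i) (fps_d (t l) Ph)))
            (fps_d (t m) (fps_d (t j) D)) e
  = if (k + i <= n)%N then fps_d (t (inord (k + i))) (fps_d (t j) D) e else 0.
Proof.
move=> eT; rewrite -(sum_gKl (fun m => fps_d (t m) (fps_d (t j) D) e)).
apply: eq_bigr => l _; apply: eq_bigr => m _; congr (_ * _).
apply: (fps_mul_constl (T := T) (b := b)) => // [|d dT].
  by apply: vanish_d => //; apply: vanish_d.
by rewrite (cs_const hPh) // addnA (addnC (k + i)%N).
Qed.

Lemma D_WDVV_rhs_dia i j e :
  \sum_(l < n.+1) \sum_(m < n.+1) gK l m *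
    fps_mul (fps_d dia (fps_d (t i) (fps_d (t l) Ph)))
            (fps_d (t m) (fps_d (t j) D)) e = 0.
Proof.
rewrite big1 // => l _; rewrite big1 // => m _.
rewrite fps_mul_eq0 ?mulr0 // => d _.
by rewrite !fps_dE (cs_supp hPh) ?mulr0 ?mul0r // !ffunE !eqxx; lia.
Qed.

Lemma val_inord1 : (inord 1 : 'I_n.+1) = 1%N :> nat.
Proof. by rewrite inordK //; lia. Qed.

Lemma D_unit e : (0 < e (t ord0))%N -> D e = 0.
Proof.
by move=> H; apply: (dec_eq0 H); rewrite fps_dB /fsub (os_unit hF) (os_unit hG) subrr.
Qed.

Lemma D_divisor e : fps_d (t (inord 1)) D e = (e T)%:R * D e.
Proof. by rewrite fps_dB /fsub (os_divisor hF) (os_divisor hG) mulrBr. Qed.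

Lemma D_wall e : fps_d s D e = - fps_d dia D e.
Proof. by rewrite !fps_dB /fsub (os_wall hF) (os_wall hG) opprB opprK addrC. Qed.

(** In the equation (diamond, 1, a - 1) the left side is the derivative of [D] in t_diamond and t_a;
    the right side is zero because [Ph] does not involve t_diamond. *)
Lemma D_dia_eq0 e (a : 'I_n.+1) : e T = b -> (1 < a)%N -> (0 < e dia)%N ->
  (0 < e (t a))%N -> D e = 0.
Proof.
move=> eT a1 ed ea; apply: (dec_eq0 ea); apply: dec_eq0 (dia) _ _ _ _.
  by rewrite ffunE var_eqE subn0.
set e' := dec _ _; have e'T : e' T = b by rewrite !ffunE !var_eqE eT !subn0.
have an := ltn_ord a.
have a1v : (inord a.-1 : 'I_n.+1) = a.-1 :> nat by rewrite inordK //; lia.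
have := @D_WDVV ord_max (inord 1) (inord a.-1) e' isT.
rewrite val_inord1 a1v D_WDVV_lhs // D_WDVV_rhs_dia val_inord1 a1v => H.
have := H isT _ e'T; have -> : (1 + a.-1 = a)%N by lia.
have -> : (a <= n)%N by lia.
by rewrite inord_val; apply; lia.
Qed.

Lemma cnt_gt0 e : (0 < cnt e)%N -> exists a, (0 < e (t a))%N.
Proof.
rewrite lt0n sum_nat_eq0 => /forallPn[a]; rewrite /= -lt0n => ea.
by exists a.
Qed.

Lemma wt_le e : (wt e <= n * cnt e)%N.
Proof.
rewrite /wt /cnt big_distrr /=; apply: leq_sum => j _.
by rewrite leq_mul2r -ltnS ltn_ord orbT.
Qed.

Lemma D_degree e : e s = 0%N ->
  (n + 2 * n * e T + 2 * cnt e + 2 * e dia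
     != 3 + n.+1 * e dia + 2 * wt e)%N -> D e = 0.
Proof.
by move=> es h; rewrite /D /fsub (os_degree hF) // (os_degree hG) // subrr.
Qed.

Hypothesis b_gt0 : (0 < b)%N.

Lemma D_nodia_eq0 e : e T = b -> e dia = 0%N -> e s = 0%N -> D e = 0.
Proof.
have [k] := ubnP (cnt e); elim: k e => // k IHk e; rewrite ltnS => ek eT ed es.
case: (leqP (cnt e) 1) => e1.
  (* With at most one insertion, n + 2nb + 2 [cnt] = 3 + 2 [wt] contradicts [wt] <= n [cnt], as n >
     1 and b > 0. *)
  apply: D_degree => //; rewrite ed eT; have := wt_le e; have : (n <= n * b)%N by nia.
  by move=> nb wt_e; apply/eqP => H; case: (cnt e) e1 wt_e H => [|[|]] //=; nia.
have [a ea] : exists a, (0 < e (t a))%N by apply: cnt_gt0; lia.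
have cnt1 : (cnt (dec (t a) e)).+1 = cnt e by rewrite -(cnt_inc a) decK.
have [c] : exists c, (0 < dec (t a) e (t c))%N by apply: cnt_gt0; lia.
set f := dec (t a) e => fc.
have cnt2 : (cnt (dec (t c) f)).+1 = cnt f by rewrite -(cnt_inc c) decK.
have ec : (0 < e (t c))%N by move: fc; rewrite ffunE; lia.
case: (posnP (e (t ord0))) => e0; last exact: D_unit.
case: (posnP (e (t (inord 1)))) => e1'; last first.
  apply: (dec_eq0 e1'); rewrite D_divisor IHk ?mulr0 //.
  - by rewrite -ltnS -(cnt_inc (inord 1)) decK.
  - by rewrite ffunE !var_eqE subn0.
  - by rewrite ffunE !var_eqE subn0.
  - by rewrite ffunE !var_eqE subn0.
have ge2 (i : 'I_n.+1) : (0 < e (t i))%N -> (1 < i)%N.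
  case: i => [[|[|i]] Hi] //.
    by rewrite (_ : Ordinal Hi = ord0) ?e0 //; apply: val_inj.
  by rewrite (_ : Ordinal Hi = inord 1) ?e1' //; apply: val_inj; rewrite /= val_inord1.
have a2 := ge2 _ ea; have c2 := ge2 _ ec; have cn := ltn_ord c.
apply: (dec_eq0 ea); rewrite -/f; apply: (dec_eq0 fc).
set g := dec _ f; have gT : g T = b by rewrite !ffunE !var_eqE !subn0.
have c1v : (inord c.-1 : 'I_n.+1) = c.-1 :> nat by rewrite inordK //; lia.
(* The equation (a, c - 1, 1) replaces the pair (a, c) by (a + c - 1, 1). The divisor axiom then
   removes the index 1, which leaves one insertion fewer. *)
have := @D_WDVV (low a) (inord c.-1) (inord 1) g.
rewrite D_WDVV_lhs // D_WDVV_rhs // c1v val_inord1.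
have -> : (c.-1 + 1 = c)%N by lia.
have -> : (c <= n)%N by lia.
rewrite inord_val => H; rewrite fps_dC {}H //; last first.
- by lia.
- by rewrite t_n0 //; lia.
- case: ifP => // acn; rewrite fps_dE D_divisor IHk ?mulr0 //.
  + by rewrite cnt_inc cnt2; move: ek; rewrite -cnt1.
  + by rewrite !ffunE !var_eqE !subn0 addn0.
  + by rewrite !ffunE !var_eqE !subn0 addn0.
  + by rewrite !ffunE !var_eqE !subn0 addn0.
Qed.

(** * The coefficients of [T^b t_diamond^p] *)

Lemma d_dia_TP (f : fps K (var n)) c p :
  fps_d dia f (TP c p) = p.+1%:R * f (TP c p.+1).
Proof. by rewrite fps_dE inc_dia_TP TP_dia. Qed.

Lemma d_t_TP (f : fps K (var n)) c p i :
  fps_d (t i) f (TP c p) = f (inc (t i) (TP c p)).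
Proof. by rewrite fps_dE TP_t mul1r. Qed.

Lemma Ph_supp i j l c p : (0 < p)%N ->
  fps_d (t i) (fps_d (t j) (fps_d (t l) Ph)) (TP c p) = 0.
Proof.
by move=> p0; rewrite !fps_dE (cs_supp hPh) ?mulr0 // !ffunE !var_eqE; lia.
Qed.

Lemma vanish_Ph i j l : (n < i + (j + l))%N ->
  vanish T 1 (fps_d (t i) (fps_d (t j) (fps_d (t l) Ph))).
Proof.
move=> H e; rewrite ltnS leqn0 => /eqP eT; rewrite (cs_const hPh) //.
by rewrite gtn_eqF // mulr0 mul0r.
Qed.

(** For T t_n t_diamond^p the degree condition reads (n - 1) p = n - 1. *)
Lemma dia_n_TP1 (p : nat) : p != 1%N -> F (inc (t ord_max) (TP 1 p)) = 0.
Proof.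
move=> p1; apply: (os_degree hF); first by rewrite !ffunE.
rewrite cnt_inc wt_inc cnt_TP wt_TP !ffunE !var_eqE /=.
by apply: contraNneq p1 => H; apply/eqP; nia.
Qed.

Lemma dia_0 d : fps_d dia (fps_d (t ord0) F) d = (d == e0)%:R.
Proof.
rewrite fps_dE (os_unit hF).
have -> : (inc dia d == inc s e0) = false.
  by apply/eqP => /(congr1 (fun e : expo _ => e dia)); rewrite !ffunE !var_eqE; lia.
case: (eqVneq d e0) => [->|nd]; first by rewrite eqxx ffunE subr0 mulr1.
suff /negbTE -> : inc dia d != inc dia e0 by rewrite subr0 mulr0.
apply: contraNneq nd => E; apply/eqP/expoP => x.
by move/ffunP/(_ x): E; rewrite !ffunE; lia.
Qed.

(* OGW_1(diamond, h^n) = -2, from the T-coefficient of WDVV (diamond, 1, n - 1);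
   it does not depend on the initial value. *)
Lemma dia_n_value : F (inc (t ord_max) (TP 1 1)) = - 2.
Proof.
have n1v : (inord n.-1 : 'I_n.+1) = n.-1 :> nat by rewrite inordK //; lia.
have := os_WDVV hF ord_max (inord 1) (inord n.-1) (TP 1 0).
have v1 := t_n0 (i := inord 1); rewrite val_inord1 in v1.
have vn := t_n0 (i := inord n.-1); rewrite n1v in vn.
have {}v1 := v1 isT; have {vn} vn : t (inord n.-1) != t ord0 by apply: vn; lia.
have vd : dia != t ord0 by rewrite dia_t.
(* Both quadratic terms are products of two series vanishing at T = 0, so they start at T^2. *)
rewrite (vanish_mul (T := T) (a := 1) (b := 1)) ?TP_T // ?addr0; last 2 first.
- exact: open_vanish hF _ _ _ _.
- exact: open_vanish hF _ _ _ _.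
rewrite (vanish_mul (T := T) (a := 1) (b := 1)
  (f := fps_d (tv ord_max) (fps_d (t (inord 1)) F))) ?TP_T // ?addr0; last 2 first.
- exact: open_vanish hF _ _ _ _.
- exact: open_vanish hF _ _ _ _.
rewrite [X in _ = X]big1 => [|l _]; last first.
  rewrite big1 // => m _; rewrite fps_mul_eq0 ?mulr0 // => d _.
  by rewrite !fps_dE (cs_supp hPh) ?mulr0 ?mul0r // !ffunE !eqxx; lia.
(* For l = 0 the open factor is the constant 1 and [Ph] contributes its T-coefficient; for other [l]
   the open factor starts at T and [Ph] contributes a classical product. *)
have H l m : fps_mul (fps_d dia (fps_d (t l) F))
    (fps_d (t m) (fps_d (t (inord 1)) (fps_d (t (inord n.-1)) Ph))) (TP 1 0)
  = (l == ord0)%:R * fps_d (t m) (fps_d (t (inord 1))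
       (fps_d (t (inord n.-1)) Ph)) (TP 1 0)
    + fps_d dia (fps_d (t l) F) (TP 1 0) * (2 * (m + (1 + n.-1) == n)%N%:R).
  case: (eqVneq l ord0) => [->|nl].
    rewrite !dia_0 (@fps_mul_single _ _ e0) => [|x|d _ nd].
    - have -> : esub (TP 1 0) e0 = TP 1 0.
        by apply: expoP => x; rewrite !ffunE subn0.
      have /negbTE -> : TP 1 0 != e0.
        by apply/eqP => /(congr1 (fun e : expo _ => e T)); rewrite !ffunE.
      by rewrite dia_0 eqxx mul0r addr0.
    - by rewrite ffunE.
    - by rewrite dia_0 (negbTE nd) mul0r.
  rewrite mul0r add0r; apply: (fps_mul_constr (T := T) (b := 1)).
  - exact: open_vanish hF _ _ _ _.
  - by move=> d dT; rewrite (cs_const hPh) // val_inord1 n1v.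
  - by rewrite TP_T.
under eq_bigr do under eq_bigr do rewrite H mulrDr.
under eq_bigr do rewrite big_split /=.
rewrite big_split /= sum_gKr.
have nn : (1 + n.-1 = n)%N by lia.
rewrite nn leqnn (bigD1 ord0) //= [X in _ + X + _]big1 ?addr0; last first.
  by move=> l /negbTE nl; rewrite big1 // => m _; rewrite nl mul0r mulr0.
rewrite (bigD1 ord_max) //= [X in _ + X + _]big1 ?addr0; last first.
  move=> m nm; rewrite /gK /= add0n.
  have /negbTE -> : (m != n :> nat)%N by [].
  by rewrite !mul0r.
have -> : inord n = ord_max :> 'I_n.+1 by apply: val_inj; rewrite /= inordK.
rewrite /gK add0n eqxx mul1r mul1r.
rewrite (fps_dC (t (inord 1)) (t (inord n.-1))) (fps_dC (t ord_max)).
rewrite (fps_dC (t ord_max)) (cs_line hPh) d_dia_TP d_t_TP mul1r => E.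
(* Here 1/2 is the entry (0, n) of [gK] and 4 is the count of lines. *)
have E2 : 2^-1 * 4 = 2 :> K by field.
by apply/eqP; rewrite -addr_eq0 addrC -E2 E.
Qed.

Hypothesis init : F (TP 1 3) = G (TP 1 3).

Lemma D_TP_eq0 p : D (TP b p) = 0.
Proof.
case: (eqVneq (n + 2 * n * b + 2 * p)%N (3 + n.+1 * p)%N) => [deg|deg]; last first.
  by apply: D_degree; rewrite ?TP_s // cnt_TP wt_TP TP_T TP_dia !muln0 !addn0.
(* The degree condition is (n - 1) p = 2nb + n - 3. For b = 1 it gives p = 3, the monomial of the
   initial value. *)
case: (eqVneq b 1%N) => [b1|nb1].
  have -> : p = 3 by nia.
  by rewrite b1 /D /fsub init subrr.
(* For b > 1 the degree condition gives p - (2b + 1) = 2 (b - 1) / (n - 1) > 0. *)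
have p3 : (2 < p)%N by nia.
have pb : p != (2 * b).+1 by nia.
(* From here on [p] is lowered by 2: the coefficient studied is that of T^b t_diamond^(p+2). *)
case: p => [|[|p]] // in deg p3 pb *.
set x := D _.
have n1v : (inord n.-1 : 'I_n.+1) = n.-1 :> nat by rewrite inordK //; lia.
have dl l : fps_d dia (fps_d (t l) D) (TP b p.+1)
    = (l == inord 1)%:R * (p.+2%:R * (b%:R * x)).
  rewrite d_dia_TP; case: (eqVneq l (inord 1)) => [->|nl].
    by rewrite D_divisor TP_T mul1r.
  rewrite d_t_TP mul0r; case: (posnP l) => l0.
    rewrite D_unit ?mulr0 // (_ : l = ord0); last exact: val_inj.
    by rewrite !ffunE !var_eqE.
  rewrite (D_dia_eq0 (a := l)) ?mulr0 //.
  - by rewrite !ffunE !var_eqE addn0.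
  - by move: nl l0; rewrite -val_eqE /= val_inord1; lia.
  - by rewrite !ffunE !var_eqE.
  - by rewrite !ffunE !var_eqE.
have Dn h : D (inc (t ord_max) (TP b h)) = 0.
  case: (posnP h) => [->|h0].
    by apply: D_nodia_eq0; rewrite !ffunE !var_eqE ?addn0.
  by apply: (D_dia_eq0 (a := ord_max)) => //; rewrite !ffunE !var_eqE ?addn0.
(* In [T]-degree b + 1 each product pairs [D] in degree [b] with another factor in degree 1; the
   products containing D_(1,n) or D_(n,diamond) drop out by [Dn]. *)
have := D_WDVV_gen ord_max (inord 1) ord_max (TP b.+1 p.+1).
have v1 : t (inord 1) != t ord0 by rewrite t_n0 // val_inord1.
have vn : t ord_max != t ord0 by rewrite t_n0 //=; lia.
have vd : dia != t ord0 by rewrite dia_t.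
rewrite D_WDVV_rhs_dia add0r !fps_mulB -!fps_dB -/D.
rewrite (fps_mul_TP_eq0 (f := fps_d (tv ord_max) (fps_d dia G))); first last.
- by move=> h; rewrite fps_dC d_t_TP D_divisor Dn mulr0.
- by apply: vanish_d => //; apply: vanish_d.
- exact: open_vanish hG _ _ _ _.
rewrite (fps_mul_TP_eq0 (f := fps_d (tv ord_max) (fps_d (t (inord 1)) G))); first last.
- by move=> h; rewrite fps_dC d_dia_TP d_t_TP Dn mulr0.
- by apply: vanish_d => //; apply: vanish_d.
- exact: open_vanish hG _ _ _ _.
rewrite !addr0 (fps_mul_TP (q := 1)) //; first last.
- move=> h nh; rewrite fps_dC d_t_TP (os_divisor hF) dia_n_TP1 ?mulr0 //.
- exact: open_vanish hF _ _ _ _.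
- by apply: vanish_d => //; apply: vanish_d.
rewrite (fps_mul_TP (q := 0)) //; first last.
- by move=> h nh; rewrite fps_dC d_dia_TP d_t_TP dia_n_TP1 ?mulr0.
- exact: open_vanish hF _ _ _ _.
- by apply: vanish_d => //; apply: vanish_d.
(* Since m + 1 + n > n, this derivative of [Ph] has no [T]-free part. Only l = 1, m = n - 1
   survives, with factor 4 / 2. *)
have H l m : gK l m * fps_mul (fps_d (tv ord_max) (fps_d (t l) D))
    (fps_d (t m) (fps_d (t (inord 1)) (fps_d (t ord_max) Ph))) (TP b.+1 p.+1)
  = (if (l == inord 1) && (m == inord n.-1) then 2 * (p.+2%:R * (b%:R * x)) else 0).
  rewrite (fps_mul_TP (q := 0)) //; first last.
  - by move=> h nh; apply: Ph_supp; lia.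
  - by apply: vanish_Ph; rewrite val_inord1 /=; lia.
  - by apply: vanish_d => //; apply: vanish_d.
  rewrite subn0 dl; case: (eqVneq l (inord 1)) => [->|_] /=; last by rewrite !mul0r mulr0.
  rewrite /gK val_inord1; case: (eqVneq m (inord n.-1)) => [->|nm].
    rewrite (cs_line hPh) n1v (_ : 1 + n.-1 = n)%N; last by lia.
    by rewrite eqxx !mul1r; field.
  have /negbTE -> : (1 + m != n)%N.
    by move: nm; rewrite -val_eqE /= n1v; lia.
  by rewrite !mul0r.
under eq_bigr do under eq_bigr do rewrite H.
rewrite (bigD1 (inord 1)) //= (bigD1 (inord n.-1)) //= !eqxx /= !big1 ?addr0; first last.
- by move=> m /negbTE ->.
- by move=> l /negbTE ->; rewrite big1.
have -> : fps_d (t (inord 1)) (fps_d (t ord_max) F) (TP 1 1) = - 2.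
  by rewrite fps_dC d_t_TP (os_divisor hF) dia_n_value !ffunE !var_eqE mul1r.
have -> : fps_d (t ord_max) (fps_d dia F) (TP 1 0) = - 2.
  by rewrite fps_dC d_dia_TP d_t_TP dia_n_value mul1r.
rewrite subSS !subn0 dl eqxx mul1r !d_dia_TP -/x => E.
(* The last factor is nonzero by [pb]. *)
have : (2 * p.+2%:R * (2 * b%:R - p.+1%:R)) * x = 0.
  by move/eqP: E; rewrite -subr_eq0 => /eqP <-; ring.
move/eqP; rewrite !mulf_eq0 !pnatr_eq0 /= subr_eq0 -natrM eqr_nat.
by case/orP => [/eqP H2|/eqP //]; lia.
Qed.

(** Wall-crossing trades s for t_diamond and the divisor axiom removes t_1, so the induction is on
    the sum of these two exponents. The remaining monomials fall under the preceding cases. *)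
Lemma D_eq0 e : e T = b -> D e = 0.
Proof.
have [k] := ubnP (e s + e (t (inord 1)))%N; elim: k e => // k IHk e.
rewrite ltnS => ek eT; case: (posnP (e s)) => es; last first.
  apply: (dec_eq0 es); rewrite D_wall fps_dE IHk ?mulr0 ?oppr0 //.
    by rewrite !ffunE !var_eqE; lia.
  by rewrite !ffunE !var_eqE; lia.
case: (posnP (e dia)) => ed; first exact: D_nodia_eq0.
case: (posnP (e (t ord0))) => e0; last exact: D_unit.
case: (posnP (e (t (inord 1)))) => e1; last first.
  apply: (dec_eq0 e1); rewrite D_divisor IHk ?mulr0 //.
    by rewrite !ffunE !var_eqE; lia.
  by rewrite !ffunE !var_eqE; lia.
case: (pickP (fun i => (0 < e (t i))%N)) => [a ea|ea].
  apply: (@D_dia_eq0 e a) => //; case: a ea => [[|[|a]] Ha] //.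
    by rewrite (_ : Ordinal Ha = ord0) ?e0 //; apply: val_inj.
  by rewrite (_ : Ordinal Ha = inord 1) ?e1 //; apply: val_inj; rewrite /= val_inord1.
rewrite (eq_TP es) ?eT ?D_TP_eq0 // => i.
by have := ea i; lia.
Qed.

End Uniqueness.

Lemma open_series_unique Ph F G : (1 < n)%N -> closed_series Ph ->
  open_series Ph F -> open_series Ph G -> F (TP 1 3) = G (TP 1 3) ->
  forall e, F e = G e.
Proof.
move=> n1 hPh hF hG init.
suff H b : vanish T b (fsub F G).
  by move=> e; apply/eqP; rewrite -subr_eq0; apply/eqP/(H (e T).+1).
elim: b => [//|b IHb] e; rewrite ltnS leq_eqVlt => /orP[/eqP eT|]; last exact: IHb.
case: (posnP b) => b0; last exact: (D_eq0 n1 hPh hF hG IHb).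
(* In [T]-degree 0 the zero and unit axioms prescribe every coefficient. *)
rewrite b0 in eT; case: (posnP (e (t ord0))) => e0.
  by rewrite /fsub (os_zero hF) // (os_zero hG) // subrr.
by apply: (dec_eq0 e0); rewrite fps_dB /fsub (os_unit hF) (os_unit hG) subrr.
Qed.

End Recursion.

(** * Multisets of insertions *)

Section Multiset.
Variables (M : eqType) (N : nat) (G : 'I_N -> M).

(** The insertion lists of [Phi] and [Omega], for arbitrary classes [G] and multiplicities [c]. *)
Definition mset (c : 'I_N -> nat) : seq M :=
  flatten [seq nseq (c j) (G j) | j : 'I_N].

Lemma count_mset a c : count a (mset c) = (\sum_j a (G j) * c j)%N.
Proof.
rewrite count_flatten sumnE !big_map.
by apply: eq_bigr => j _; rewrite count_nseq.
Qed.

Lemma perm_mset_inc (c c' : 'I_N -> nat) i : (forall j, c' j = c j + (j == i))%N ->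
  perm_eq (mset c') (G i :: mset c).
Proof.
move=> H; apply/permP => a; rewrite /= !count_mset.
under eq_bigr do rewrite H mulnDr.
rewrite big_split /= addnC; congr addn.
rewrite (bigD1 i) //= eqxx muln1 big1 ?addn0 // => j /negbTE ->.
by rewrite muln0.
Qed.

Lemma mset0 (c : 'I_N -> nat) : (forall j, c j = 0%N) -> mset c = [::].
Proof.
move=> H; apply: size0nil; rewrite -count_predT count_mset big1 // => j _.
by rewrite H muln0.
Qed.

Lemma mset_nil (c : 'I_N -> nat) : mset c = [::] -> forall j, c j = 0%N.
Proof.
move=> /(congr1 size); rewrite -count_predT count_mset /= => /eqP.
rewrite sum_nat_eq0 => /forallP H j.
by have /eqP := implyP (H j) isT; rewrite mul1n.
Qed.

Lemma mset_one (c : 'I_N -> nat) a : mset c = [:: a] ->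
  exists i, a = G i /\ forall j, c j = (j == i).
Proof.
move=> H; case: (pickP (fun i => 0 < c i)%N) => [i ci|c0]; last first.
  have c0' j : c j = 0%N by have := c0 j; case: (c j).
  by rewrite mset0 in H.
have P : perm_eq (mset c) (G i :: mset (fun j => c j - (j == i))%N).
  by apply: perm_mset_inc => j; case: eqP => [->|_]; rewrite ?subnK ?subn0 ?addn0.
have s0 : mset (fun j => c j - (j == i))%N = [::].
  by apply: size0nil; have := perm_size P; rewrite H => -[].
exists i; split.
  by move: P; rewrite H s0 perm_sym => /perm_consP[k [u [/=]]]; case: k => [|k] //= [->].
move=> j; have := mset_nil s0 j; case: eqP => [->|_]; last by rewrite subn0.
by move: ci => /=; lia.
Qed.

End Multiset.

Lemma map_mset (M M' : eqType) N (G : 'I_N -> M) (f : M -> M') c :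
  map f (mset G c) = mset (f \o G) c.
Proof.
rewrite /mset map_flatten -map_comp; congr flatten.
by apply: eq_map => j /=; rewrite map_nseq.
Qed.

(** * Rescaling by a complex number *)

Section Twist.
Variables (R : realType) (n : nat).
Notation K := R[i]%C.
Notation T := (Tv n).
Notation s := (sv n).
Implicit Types (e : expo (var n)) (f g : fps R (var n)) (z : K).

Definition weight e : nat := (e s + e (dia n))%N.
Definition vweight (x : var n) : nat := ((s == x) + (dia n == x))%N.
(** The substitution of z s for s and z t_diamond for t_diamond, over the complex numbers. *)
Definition tw z f : fps K (var n) := fun e => z ^+ weight e * (f e)%:C%C.
Definition fscale (a : K) (h : fps K (var n)) : fps K (var n) := fun e => a * h e.

Lemma weight_inc x e : weight (inc x e) = (weight e + vweight x)%N.
Proof. by rewrite /weight !ffunE addnACA. Qed.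

Lemma tw_d x z f : fps_d x (tw z f) = fscale (z ^+ vweight x) (tw z (fps_d x f)).
Proof.
apply/funext => e; rewrite /fscale /tw !fps_dE weight_inc exprD rmorphM rmorph_nat.
by rewrite mulrCA mulrA [z ^+ _ * z ^+ _]mulrC -!mulrA [z ^+ weight e * (_ * _)]mulrCA.
Qed.

Lemma fscale_d x a (h : fps K (var n)) : fps_d x (fscale a h) = fscale a (fps_d x h).
Proof. by apply/funext => e; rewrite /fscale !fps_dE mulrCA. Qed.

Lemma fscaleA a b (h : fps K (var n)) : fscale a (fscale b h) = fscale (a * b) h.
Proof. by apply/funext => e; rewrite /fscale mulrA. Qed.

Lemma fscale_mul a b (g h : fps K (var n)) e :
  fps_mul (fscale a g) (fscale b h) e = a * b * fps_mul g h e.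
Proof.
by rewrite /fps_mul mulr_sumr; apply: eq_bigr => d _; rewrite /fscale mulrACA.
Qed.

Lemma tw_mul z f g e : fps_mul (tw z f) (tw z g) e = tw z (fps_mul f g) e.
Proof.
rewrite /tw /fps_mul rmorph_sum mulr_sumr; apply: eq_bigr => d _ /=.
rewrite rmorphM mulrACA -exprD; congr (_ ^+ _ * _).
by rewrite /weight !ffunE addnACA !subnKC // -ltnS ltn_ord.
Qed.

Lemma vweight_t i : vweight (t i) = 0%N.
Proof. by rewrite /vweight !var_eqE. Qed.

Lemma vweight_dia : vweight (dia n) = 1%N.
Proof. by rewrite /vweight !var_eqE. Qed.

End Twist.

(** * Closed invariants *)

Section Geometry.
Variables (R : realType) (n : nat).
Hypothesis n_gt1 : (1 < n)%N.
Variable GW : closed_family R n.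
Hypothesis hGW : closed_GW_quadric GW.
Notation K := R[i]%C.
Notation T := (Tv n).
Notation s := (sv n).
Implicit Types (e : expo (var n)) (z : K).

Lemma prod_fact_inc (I : finType) (c c' : I -> nat) i :
  (forall j, c' j = c j + (j == i))%N ->
  (\prod_j (c' j)`! = (c i).+1 * \prod_j (c j)`!)%N.
Proof.
move=> H; rewrite (bigD1 i) //= (bigD1 i (F := fun j => (c j)`!)) //= mulnA -factS.
rewrite H eqxx addn1; congr muln; apply: eq_bigr => j /negbTE ji.
by rewrite H ji addn0.
Qed.

Definition clist e : seq (HX R n) := mset (@Delta R n) (fun j => e (t j)).
Definition cfact e : nat := (\prod_(j < n.+1) (e (t j))`!)%N.
(* The series Phi with the insertions A prepended: its derivatives are of the same
   shape, with one more insertion. *)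
Definition Phi_ins (A : seq (HX R n)) : fps R (var n) := fun e =>
  if weight e == 0%N then GW (e T)%:Z (A ++ clist e) / (cfact e)%:R else 0.

Lemma PhiE : Phi GW = Phi_ins [::].
Proof. by apply/funext => e; rewrite /Phi_ins addn_eq0. Qed.

Lemma GW_perm beta A B : perm_eq A B -> GW beta A = GW beta B.
Proof. exact: cGW_symmetric. Qed.

Lemma Phi_ins_d i A : fps_d (t i) (Phi_ins A) = Phi_ins (Delta R i :: A).
Proof.
apply/funext => e; rewrite fps_dE /Phi_ins weight_inc vweight_t addn0.
case: ifP => _; last by rewrite mulr0.
have H j : inc (t i) e (t j) = (e (t j) + (j == i))%N by rewrite ffunE.
rewrite /cfact (prod_fact_inc H) natrM.
rewrite (@GW_perm _ _ ( (Delta R i :: A) ++ clist e)); last first.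
  by rewrite -cat1s -catA perm_sym perm_catCA perm_cat2l perm_sym; apply: perm_mset_inc.
rewrite !ffunE !var_eqE addn0 invfM mulrCA; congr (_ * _).
by rewrite mulrA mulfV ?mul1r // pnatr_eq0.
Qed.

Lemma sum_delta (V : lmodType R) N (i : 'I_N) (f : 'I_N -> V) :
  \sum_j (delta_mx 0 i : 'rV[R]_N) 0 j *: f j = f i.
Proof.
rewrite (bigD1 i) //= mxE !eqxx scale1r big1 ?addr0 // => j /negbTE ji.
by rewrite mxE ji scale0r.
Qed.

Lemma cupX_Delta (i j : 'I_n.+1) : cupX (Delta R i) (Delta R j)
  = if (i + j <= n)%N then Delta R (inord (i + j)) else 0.
Proof.
rewrite /cupX; under eq_bigr do under eq_bigr do rewrite -scalerA.
under eq_bigr do rewrite -scaler_sumr.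
by rewrite sum_delta sum_delta.
Qed.

Lemma cup0X b : cupX (0 : HX R n) b = 0.
Proof.
by rewrite /cupX big1 // => i _; rewrite big1 // => j _; rewrite mxE mul0r scale0r.
Qed.

Lemma intX_Delta (i : 'I_n.+1) : intX (Delta R i) = 2 * (i == n :> nat)%:R.
Proof. by rewrite /intX mxE eqxx eq_sym -val_eqE. Qed.

Lemma intX_Delta3 (i j l : 'I_n.+1) : intX (cupX (cupX (Delta R i) (Delta R j)) (Delta R l))
  = 2 * (i + (j + l) == n)%N%:R.
Proof.
have int0 : intX (0 : HX R n) = 0 by rewrite /intX mxE mulr0.
rewrite cupX_Delta addnA; case: ifP => [ij|ij]; last first.
  by rewrite cup0X int0 (_ : (_ == n)%N = false) ?mulr0 //; lia.
rewrite cupX_Delta inordK ?ltnS //; case: ifP => [ijl|ijl]; last first.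
  by rewrite int0 (_ : (_ == n)%N = false) ?mulr0 //; lia.
by rewrite intX_Delta inordK ?ltnS.
Qed.

Lemma tw_td i z f : fps_d (t i) (tw z f) = tw z (fps_d (t i) f : fps R (var n)).
Proof.
by rewrite tw_d vweight_t; apply/funext => e; rewrite /fscale mul1r.
Qed.

Definition PhiC : fps K (var n) := tw 1 (Phi GW).

Lemma Phi_supp e : weight e != 0%N -> Phi GW e = 0.
Proof. by rewrite PhiE /Phi_ins => /negbTE ->. Qed.

(** All monomials of [Phi] have weight 0, so rescaling leaves it unchanged. *)
Lemma PhiC_tw z : PhiC = tw z (Phi GW).
Proof.
apply/funext => e; rewrite /PhiC /tw; case: (eqVneq (weight e) 0%N) => [->//|we].
by rewrite Phi_supp // !mulr0.
Qed.

Lemma closed_series_PhiC : closed_series PhiC.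
Proof.
split=> [e we|i j l e eT|].
- by rewrite /PhiC /tw Phi_supp ?mulr0 // -lt0n.
- rewrite /PhiC !tw_td PhiE !Phi_ins_d /tw expr1n mul1r /Phi_ins eT /=.
  case: ifP => we; last first.
    rewrite (_ : (e == _) = false) ?mulr0 //; apply/eqP => E.
    by move: we; rewrite /weight E !ffunE.
  (* Degree-zero invariants have exactly three arguments, and the three derivatives already supply
     them. *)
  rewrite (cGW_zero hGW); case E : (clist e) => [|a A] /=; last first.
    rewrite (_ : (e == _) = false) ?mulr0 ?mul0r //; apply/eqP => E'.
    by move: E; rewrite /clist mset0 // => k; rewrite E' ffunE.
  have -> : e = [ffun=> 0%N].
    have et k : e (t k) = 0%N by exact: mset_nil E k.
    move: we; rewrite addn_eq0 => /andP[/eqP es /eqP ed].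
    by apply: expoP; apply: var_ind => [|||k]; rewrite ?eT ?es ?ed ?et ffunE.
  rewrite /cfact big1 => [|k _]; last by rewrite ffunE.
  by rewrite divr1 intX_Delta3 eqxx mulr1 rmorphM !rmorph_nat.
- rewrite /PhiC !tw_td PhiE !Phi_ins_d /tw expr1n mul1r /Phi_ins.
  rewrite /weight TP_s TP_dia TP_T /= /clist mset0 => [|k]; last by rewrite TP_t.
  rewrite /cfact big1 => [|k _]; last by rewrite TP_t.
  rewrite divr1 (@GW_perm _ _
    (rcons [:: Delta R (inord n.-1); Delta R ord_max] (Delta R (inord 1)))).
    rewrite (cGW_divisor hGW) //; last first.
      apply/forallP => j; rewrite mxE eqxx /=; case: (eqVneq j (inord 1)) => [->|_] /=.
        by rewrite /degHX inordK ?implybT //; lia.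
      by rewrite eqxx.
    by rewrite (cGW_line hGW) /intbX mxE !eqxx mul1r mul1r rmorph_nat.
  by rewrite /= perm_cons -(perm_rot 1).
Qed.

End Geometry.

(** * Open invariants *)

Section OpenGeometry.
Variables (R : realType) (n : nat).
Hypothesis n_gt1 : (1 < n)%N.
Variables (GW : closed_family R n) (OGW : open_family R n).
Hypothesis hOGW : open_GW_axioms GW OGW.
Notation K := R[i]%C.
Notation T := (Tv n).
Notation s := (sv n).
Implicit Types (e : expo (var n)) (z : K) (A B : seq (HXL R n)).

Definition ilist e : seq 'I_n.+2 := mset id (fun j => e (tv j)).
Definition elist e : seq (HXL R n) := mset (@Gamma R n) (fun j => e (tv j)).
Definition efact e : nat := (\prod_(j < n.+2) (e (tv j))`!)%N.

Lemma OGW_perm beta k A B : perm_eq A B -> OGW beta k A = OGW beta k B.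
Proof. exact: (oGW_symmetric hOGW). Qed.

Lemma elistE e : elist e = map (@Gamma R n) (ilist e).
Proof. by rewrite map_mset. Qed.

Lemma OmegaE e :
  Omega OGW e = OGW (e T)%:Z (e s) (elist e) / ((e s)`! * efact e)%:R.
Proof. by []. Qed.

Lemma inc_tv (i j : 'I_n.+2) e : inc (tv i) e (tv j) = (e (tv j) + (j == i))%N.
Proof. by rewrite ffunE. Qed.

(** The factor produced by the derivation cancels the growth of the factorial, so a derivative
    amounts to one more insertion. *)
Lemma d_Omega_tv i e : fps_d (tv i) (Omega OGW) e
  = OGW (e T)%:Z (e s) (Gamma R i :: elist e) / ((e s)`! * efact e)%:R.
Proof.
rewrite fps_dE OmegaE !ffunE !addn0 /efact (prod_fact_inc (fun j => inc_tv i j e)).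
rewrite (OGW_perm _ _ (perm_mset_inc _ (fun j => inc_tv i j e))) mulnCA natrM.
by rewrite invfM mulrCA; congr (_ * _); rewrite mulrA mulfV ?mul1r // pnatr_eq0.
Qed.

Lemma d_Omega_s e : fps_d s (Omega OGW) e
  = OGW (e T)%:Z (e s).+1 (elist e) / ((e s)`! * efact e)%:R.
Proof.
rewrite fps_dE OmegaE.
have -> : elist (inc s e) = elist e.
  by congr flatten; apply: eq_map => j; rewrite ffunE addn0.
have -> : efact (inc s e) = efact e.
  by apply: eq_bigr => j _; rewrite ffunE addn0.
rewrite !ffunE eqxx addn1 addn0 factS -mulnA natrM.
by rewrite invfM mulrCA; congr (_ * _); rewrite mulrA mulfV ?mul1r // pnatr_eq0.
Qed.

Lemma Omega_wall : fps_d s (Omega OGW) = fun e => - fps_d (dia n) (Omega OGW) e.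
Proof.
by apply/funext => e; rewrite d_Omega_s d_Omega_tv (oGW_wall_crossing hOGW) mulNr.
Qed.

Lemma PR_Gamma (i : 'I_n.+2) : PR (Gamma R i) = (i == ord_max)%:R.
Proof. by rewrite /PR mxE eqxx eq_sym. Qed.

(** Only two invariants with an insertion Gamma_0 are nonzero: the one paired with Gamma_diamond,
    equal to 1, and the one with a single boundary point, equal to -1. *)
Lemma Omega_unit e : fps_d (t ord0) (Omega OGW) e
  = (e == inc (dia n) (e0 n))%:R - (e == inc s (e0 n))%:R.
Proof.
rewrite d_Omega_tv (_ : low ord0 = ord0); last exact: val_inj.
rewrite (oGW_unit hOGW).
case: (eqVneq e (inc (dia n) (e0 n))) => [->|ed].
  have et j : inc (dia n) (e0 n) (tv j) = (j == ord_max).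
    by rewrite !ffunE add0n.
  have -> : elist (inc (dia n) (e0 n)) = [:: Gamma R ord_max].
    apply/perm_small_eq => //.
    rewrite (@perm_trans _ _ _ _ (perm_mset_inc (c := fun=> 0%N) (i := ord_max) _ _)) //.
      by rewrite mset0.
  rewrite !ffunE /= PR_Gamma eqxx (_ : (inc _ _ == _) = false) ?subr0.
    rewrite fact0 mul1n /efact big1 ?divr1 // => j _.
    by rewrite et; case: (j == ord_max).
  by apply/eqP => /(congr1 (fun e : expo _ => e (dia n))); rewrite !ffunE !var_eqE.
case: (eqVneq e (inc s (e0 n))) => [->|es].
  rewrite /elist mset0 => [|j]; last by rewrite !ffunE.
  rewrite !ffunE /= /efact big1 => [|j _]; last by rewrite !ffunE.
  by rewrite sub0r divr1.
rewrite subr0 (_ : match elist e with [::] => _ | _ => _ end = 0) ?mul0r //.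
case E : (elist e) => [|a [|//]].
  have et j : e (tv j) = 0%N by exact: mset_nil E j.
  case: eqP => //= -[eT]; case: eqP => //= es1; case/eqP: es.
  by apply: expoP; apply: var_ind => [|||i]; rewrite ?eT ?es1 ?et !ffunE ?eqxx.
have [i [-> et]] := mset_one E; rewrite PR_Gamma.
case: eqP => //= -[eT]; case: eqP => //= es0; case: (eqVneq i ord_max) => //= im.
case/eqP: ed; rewrite im in et.
apply: expoP; apply: var_ind => [|||j]; rewrite ?eT ?es0 ?et !ffunE ?eqxx //.
Qed.

Lemma PR_cup (i j : 'I_n.+2) : i != ord0 -> j != ord0 ->
  PR (cupXL (Gamma R i) (Gamma R j)) = 0.
Proof.
move=> i0 j0; rewrite /cupXL.
under eq_bigr do under eq_bigr do rewrite -scalerA.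
under eq_bigr do rewrite -scaler_sumr.
rewrite sum_delta sum_delta /cupGamma -val_eqE in i0 *; rewrite -val_eqE in j0.
case: ifP => [ij|_]; last by rewrite (negbTE i0) (negbTE j0) /PR mxE.
by rewrite PR_Gamma -val_eqE /= inordK ?ltn_eqF //; lia.
Qed.

Lemma Omega_zero e : e T = 0%N -> e (t ord0) = 0%N -> Omega OGW e = 0.
Proof.
move=> eT et; rewrite OmegaE eT elistE.
have n0 i : i \in ilist e -> i != ord0.
  apply: contraTneq => ->; rewrite -has_pred1 has_count count_mset -leqNgt.
  rewrite big1 // => j _ /=; case: (eqVneq j ord0) => // ->.
  by rewrite mul1n -[RHS]et; congr (e (tv _)); apply: val_inj.
rewrite (oGW_zero hOGW).
case: (ilist e) n0 => [|i [|j [|//]]] n0; rewrite ?mul0r //.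
  by rewrite (negbTE (n0 i _)) ?mem_head // andbF mul0r.
by rewrite PR_cup ?n0 ?inE ?eqxx ?orbT // if_same mul0r.
Qed.

Lemma homog_Gamma (i : 'I_n.+2) : homogXL (Gamma R i) (degHXL i).
Proof.
apply/forallP => j; rewrite mxE eqxx /=.
by case: (eqVneq j i) => [->|_]; rewrite eqxx ?implybT.
Qed.

Lemma Omega_divisor e :
  fps_d (t (inord 1)) (Omega OGW) e = (e T)%:R * Omega OGW e.
Proof.
have v1 := val_inord1 n_gt1.
rewrite d_Omega_tv OmegaE.
have /OGW_perm -> : perm_eq (Gamma R (low (inord 1)) :: elist e)
    (rcons (elist e) (Gamma R (low (inord 1)))).
  by rewrite perm_sym perm_rcons.
rewrite (oGW_divisor hOGW) ?mulrA.
  rewrite /intbXL mxE eqxx (_ : inord 1 == low (inord 1)) ?mulr1 ?mulrA //.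
  by rewrite -val_eqE /= v1 inordK.
have <- : degHXL (low (inord 1) : 'I_n.+2) = 2%N.
  by rewrite /degHXL -val_eqE /= v1; case: eqP => //; lia.
exact: homog_Gamma.
Qed.

Lemma size_ilist e : size (ilist e) = (cnt e + e (dia n))%N.
Proof.
rewrite -count_predT count_mset big_ord_recr /= mul1n; congr addn.
by apply: eq_bigr => j _; rewrite mul1n.
Qed.

Lemma deg_ilist e : sumn (map (@degHXL n) (ilist e)) = (2 * wt e + n.+1 * e (dia n))%N.
Proof.
rewrite map_mset sumn_flatten sumnE !big_map.
under eq_bigr do rewrite sumn_nseq.
rewrite big_ord_recr /= {2}/degHXL eqxx; congr addn.
rewrite /wt big_distrr; apply: eq_bigr => j _ /=.
rewrite /degHXL ifN ?mul2n -?doubleMl //.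
by rewrite -val_eqE /= ltn_eqF.
Qed.

Lemma Omega_degree e : e s = 0%N ->
  (n + 2 * n * e T + 2 * cnt e + 2 * e (dia n)
     != 3 + n.+1 * e (dia n) + 2 * wt e)%N -> Omega OGW e = 0.
Proof.
move=> es H; rewrite OmegaE es elistE.
rewrite (oGW_degree hOGW (d := map (@degHXL n) (ilist e))) ?mul0r //.
  by elim: (ilist e) => //= i I ->; rewrite homog_Gamma.
rewrite size_map size_ilist deg_ilist /maslov.
by apply: contraNneq H => H; apply/eqP; lia.
Qed.

Definition OmegaC z : fps K (var n) := fscale z^-1 (tw z (Omega OGW)).

Lemma ginvC (l m : 'I_n.+1) : (ginv R l m)%:C%C = gK K l m.
Proof. by rewrite /ginv /gK rmorphM rmorph_nat fmorphV rmorph_nat. Qed.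

Lemma d_twist (a z : K) x (f : fps R (var n)) :
  fps_d x (fscale a (tw z f)) = fscale (a * z ^+ vweight x) (tw z (fps_d x f)).
Proof. by rewrite fscale_d tw_d fscaleA. Qed.

Lemma mul_twist (a b z : K) (f g : fps R (var n)) e :
  fps_mul (fscale a (tw z f)) (fscale b (tw z g)) e
  = a * b * z ^+ weight e * (fps_mul f g e)%:C%C.
Proof. by rewrite fscale_mul tw_mul /tw mulrA. Qed.

(** Quadratic terms have one more factor z^-1 than linear ones, and one more derivative in
    t_diamond, which restores z; so all terms of the equation scale alike. The two unit terms have
    weight 1, which z^-1 compensates. *)
Lemma open_series_OmegaC z : z != 0 -> open_series (PhiC GW) (OmegaC z).
Proof.
move=> z0; split.
- by move=> e es H; rewrite /OmegaC /fscale /tw Omega_degree ?mulr0.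
- move=> e; rewrite /OmegaC fscale_d tw_td /fscale /tw Omega_unit rmorphB !rmorph_nat.
  have w1 (v : var n) : vweight v = 1%N -> e == inc v (e0 n) -> weight e = 1%N.
    by move=> vv /eqP ->; rewrite weight_inc vv /weight !ffunE.
  case E1: (e == inc (dia n) (e0 n)).
    rewrite (w1 _ _ E1) ?vweight_dia // expr1 mulrA mulVf // mul1r.
    by [].
  case E2: (e == inc s (e0 n)); last by rewrite subrr !mulr0.
  by rewrite (w1 _ _ E2) // expr1 mulrA mulVf // mul1r.
- by move=> e eT et; rewrite /OmegaC /fscale /tw Omega_zero ?mulr0.
- move=> e; rewrite /OmegaC fscale_d tw_td /fscale /tw Omega_divisor rmorphM rmorph_nat.
  by rewrite [z ^+ _ * (_ * _)]mulrCA [LHS]mulrCA.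
- move=> e; rewrite /OmegaC !fscale_d !tw_d vweight_dia Omega_wall /fscale /tw.
  by rewrite rmorphN !mulrN.
move=> u i j e.
have hPhi : PhiC GW = fscale 1 (tw z (Phi GW)).
  by rewrite (PhiC_tw GW z); apply/funext => d; rewrite /fscale mul1r.
pose c := z^-1 * z ^+ vweight (tv u) * z ^+ weight e.
have hc x : c * x = z^-1 * z ^+ vweight (tv u) * z ^+ weight e * x by [].
rewrite hPhi /OmegaC.
under eq_bigr do under eq_bigr do
  rewrite !d_twist mul_twist !vweight_t expr0 !mulr1 -hc mulrCA -ginvC -rmorphM.
under [in RHS]eq_bigr do under eq_bigr do
  rewrite !d_twist mul_twist !vweight_t expr0 !mulr1 mul1r
    [z ^+ _ * z^-1]mulrC -hc mulrCA -ginvC -rmorphM.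
rewrite !d_twist !mul_twist !vweight_t vweight_dia expr0 expr1 !mulr1 mulVf // mulr1 mul1r.
rewrite [z ^+ _ / z]mulrC -!hc.
under eq_bigr do rewrite -mulr_sumr -rmorph_sum.
under [in RHS]eq_bigr do rewrite -mulr_sumr -rmorph_sum.
rewrite -!mulr_sumr -!rmorph_sum -!mulrDr -!rmorphD; congr (c * _).
congr (real_complex R _).
(* Replacing d/ds by - d/dt_diamond turns both minus signs into plus signs. *)
have := oGW_WDVV_interior hOGW u (low j) (low i) e.
rewrite Omega_wall.
have dN x : fps_d x (fun d => - fps_d (dia n) (Omega OGW) d)
    = fun d => - fps_d x (fps_d (dia n) (Omega OGW)) d.
  by apply/funext => d; rewrite fps_dE mulrN.
by rewrite !dN fps_mulNl fps_mulNr !opprK.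
Qed.

End OpenGeometry.

(** * Individual invariants as coefficients of the superpotential *)

Section Exponents.
Variables (R : realType) (n : nat).
Implicit Types (J : seq 'I_n.+2).

Definition expn_of (b k : nat) J : expo (var n) :=
  [ffun y => match y with
             | inl (inl _) => b
             | inl (inr _) => k
             | inr j => count_mem j J
             end].

Lemma weight_expn_of b k J :
  weight (expn_of b k J) = (k + count_mem ord_max J)%N.
Proof. by rewrite /weight !ffunE. Qed.

Lemma Omega_expn_of GW (OGW : open_family R n) b k J :
  open_GW_axioms GW OGW ->
  Omega OGW (expn_of b k J)
  = OGW b%:Z k (map (@Gamma R n) J)
    / (k`! * efact (expn_of b k J))%:R.
Proof.
move=> hOGW; rewrite OmegaE !ffunE; congr (_ / _); apply: (OGW_perm hOGW).
elim: J => [|j J IHJ]; first by rewrite /elist mset0 // => j; rewrite ffunE.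
rewrite map_cons; have /permPl -> : perm_eq (elist R (expn_of b k (j :: J)))
    (Gamma R j :: elist R (expn_of b k J)).
  by apply: perm_mset_inc => i; rewrite !ffunE /= addnC eq_sym.
by rewrite perm_cons.
Qed.

Lemma OGW_wall_iter GW (OGW : open_family R n) beta k r (A : seq (HXL R n)) :
  open_GW_axioms GW OGW ->
  OGW beta (r + k)%N A = (-1) ^+ r * OGW beta k (nseq r (Gamma_diamond R n) ++ A).
Proof.
move=> hOGW; elim: r A => [|r IHr] A; first by rewrite mul1r.
rewrite addSn (oGW_wall_crossing hOGW) IHr exprS mulN1r mulNr.
by rewrite -cat1s catA -[_ ++ [:: _]]/(nseq r _ ++ nseq 1 _) -nseqD addnC.
Qed.

(** Three wall-crossings contribute the sign (-1)^3; the denominator is 3!. *)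
Lemma Omega_init GW (OGW : open_family R n) : open_GW_axioms GW OGW ->
  Omega OGW (TP n 1 3) = - OGW 1 3%N [::] / (efact (expn_of 1 0 (nseq 3 ord_max)))%:R.
Proof.
move=> hOGW.
have -> : TP n 1 3 = expn_of 1 0 (nseq 3 ord_max).
  apply: expoP; apply: var_ind => [|||i]; rewrite !ffunE ?var_eqE //=.
    by rewrite eqxx.
  by have := dia_t i; rewrite -[dia n == t i]/(ord_max == low i) => ->.
rewrite (Omega_expn_of _ _ _ hOGW) mul1n (@OGW_wall_iter _ _ _ 0 3 [::] hOGW).
by rewrite -signr_odd expr1 mulN1r opprK.
Qed.

End Exponents.

(** * From powers of i to real signs *)

Section SignRelated.
Variable R : realType.
Local Open Scope complex_scope.

(** The hypothesis says i x' = i^p x. For odd [p] one factor i cancels and i^(p-1) is the required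
    sign; for even [p] an imaginary number equals a real one. *)
Lemma sign_related_complex (p : nat) (x' x : R) :
  x'%:C = 'i^-1 * ('i ^+ p * x%:C) -> sign_related p x' x.
Proof.
move=> E; have {}E : 'i * x'%:C = 'i ^+ p * x%:C.
  by rewrite E mulrA mulfV ?mul1r // neq0Ci.
have sqi : 'i * 'i = -1 :> R[i] by rewrite -expr2 sqr_i.
have even_pow m : 'i ^+ m.*2 = ((-1) ^+ m)%:C :> R[i].
  by rewrite -mul2n exprM expr2 sqi rmorphXn rmorphN1.
rewrite /sign_related; case: ifP => op.
  have pE : p = (p.-1)./2.*2.+1 by rewrite -[LHS]odd_double_half op; lia.
  move: E; rewrite {1}pE exprS even_pow -mulrA => /(mulfI (neq0Ci _)).
  by rewrite -rmorphM => /complexI.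
have pE : p = p./2.*2 by rewrite -[LHS]odd_double_half op.
move: E; rewrite {1}pE even_pow -rmorphM => /eqP.
rewrite eq_complex /= !mul0r !mul1r ?addr0 ?subr0 ?add0r ?mulr0 ?subrr.
case/andP=> /eqP H /eqP ->.
by split=> //; move/esym/eqP: H; rewrite mulf_eq0 signr_eq0 /= => /eqP.
Qed.

End SignRelated.

Theorem proposition1p3 (R : realType) (n : nat) (n_gt1 : (1 < n)%N)
    (n_odd : odd n)
    (GW : closed_family R n) (hGW : closed_GW_quadric GW)
    (OGW OGW' : open_family R n)
    (hOGW : open_GW_axioms GW OGW)
    (hOGW13 : OGW 1 3%N [::] = initial_value R n)
    (hOGW' : open_GW_axioms GW OGW')
    (hOGW'13 : OGW' 1 3%N [::] = - initial_value R n)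
    (beta : int) (k : nat) (I : seq 'I_n.+1) :
  sign_related k (OGW' beta k (Gamma_seq R I)) (OGW beta k (Gamma_seq R I)) /\
  (forall r : nat,
     sign_related (k + r)
       (OGW' beta k (nseq r (Gamma_diamond R n) ++ Gamma_seq R I))
       (OGW beta k (nseq r (Gamma_diamond R n) ++ Gamma_seq R I))).
Proof.
suff H r : sign_related (k + r)
       (OGW' beta k (nseq r (Gamma_diamond R n) ++ Gamma_seq R I))
       (OGW beta k (nseq r (Gamma_diamond R n) ++ Gamma_seq R I)).
  by split=> //; have := H 0%N; rewrite addn0.
case: (ltrP beta 0) => [b0|].
  rewrite (oGW_effective hOGW) // (oGW_effective hOGW') //.
  by rewrite /sign_related; case: ifP; rewrite ?mulr0.
case: beta => // b _.
have uniq e : OmegaC OGW' 1 e = OmegaC OGW ('i)%C e.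
  apply: (open_series_unique n_gt1 (closed_series_PhiC n_gt1 hGW)).
  - by apply: (open_series_OmegaC n_gt1 hOGW'); exact: oner_neq0.
  - by apply: (open_series_OmegaC n_gt1 hOGW); exact: neq0Ci.
  (* The monomial T t_diamond^3 has weight 3, so the scaling factor is i^-1 i^3 = -1, which matches
     the opposite initial values. *)
  rewrite /OmegaC /fscale /tw (Omega_init hOGW) (Omega_init hOGW') hOGW13 hOGW'13.
  rewrite /weight TP_s TP_dia expr1n invr1 !mul1r add0n exprS -mulrA mulKf ?neq0Ci //.
  by rewrite sqr_i mulN1r -rmorphN opprK mulNr opprK.
pose J := nseq r (ord_max : 'I_n.+2) ++ map (@low n) I.
have JE : nseq r (Gamma_diamond R n) ++ Gamma_seq R I = map (@Gamma R n) J.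
  by rewrite map_cat map_nseq -map_comp.
have cJ : count_mem ord_max J = r.
  rewrite count_cat count_nseq /= eqxx mul1n count_map.
  rewrite (eq_count (a2 := pred0)) ?count_pred0 ?addn0 // => i /=.
  exact: t_dia.
have := uniq (expn_of b k J).
rewrite /OmegaC /fscale /tw (Omega_expn_of _ _ _ hOGW) (Omega_expn_of _ _ _ hOGW').
rewrite weight_expn_of cJ expr1n invr1 !mul1r -JE.
(* Both coefficients carry the same product of factorials, which is cancelled. *)
set N := (_ * _)%N; have N0 : (N%:R : R) != 0.
  by rewrite pnatr_eq0 -lt0n muln_gt0 fact_gt0 prodn_gt0 // => j; exact: fact_gt0.
rewrite !(rmorphM (real_complex R)) !mulrA => /mulIf E.
apply: sign_related_complex; rewrite mulrA; apply: E.
by rewrite fmorph_eq0 invr_eq0 N0.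
Qed.
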